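(* Let $A$ be a finite dimensional quasi-hereditary algebra over a field with a simple preserving duality. Then there exists a unique (up to isomorphism) faithful basic tilting $A$-module $T$ such that (1) $A=\operatorname{End}_{\operatorname{End}_A(T)}(T)$ (via the canonical map); and (2) if $T'$ is another faithful tilting $A$-module satisfying $A=\operatorname{End}_{\operatorname{End}_A(T')}(T')$, then $T$ is (isomorphic to) a direct summand of $T'$.
   Context: Let $K$ be a field and $A$ a finite dimensional unital $K$-algebra; modules are finite dimensional left modules (category $A$-mod). $\{L(\lambda)\mid\lambda\in\Lambda^+\}$ is a complete set of representatives of isomorphism classes of simple $A$-modules, and $A$ is assumed split, i.e. $\operatorname{End}_A(L(\lambda))=K$. $P(\lambda)$, $I(\lambda)$ are the projective cover and injective hull of $L(\lambda)$; $\operatorname{Tr}_M(N)$ is the sum of the images of all homomorphisms $M\to N$. Quasi-hereditary: there is a partial order $\preceq$ on $\Lambda^+$ such that, with $\Delta(\lambda):=P(\lambda)/\operatorname{Tr}_{\bigoplus_{\mu\succ\lambda}P(\mu)}(P(\lambda))$, for each $\lambda$ the kernel of $P(\lambda)\twoheadrightarrow\Delta(\lambda)$ has a filtration with subquotients $\Delta(\mu)$, $\mu\succ\lambda$, and the kernel of $\Delta(\lambda)\twoheadrightarrow L(\lambda)$ has a filtration with subquotients $L(\mu)$, $\mu\prec\lambda$. The costandard module $\nabla(\lambda)$ is the largest submodule of $I(\lambda)$ with no composition factor $L(\mu)$, $\mu\succ\lambda$. $\mathcal{F}(\Delta)$ (resp. $\mathcal{F}(\nabla)$) is the full subcategory of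 modules having a filtration with all subquotients of the form $\Delta(\lambda)$ (resp. $\nabla(\lambda)$). A tilting module is an object of $\mathcal{F}(\Delta)\cap\mathcal{F}(\nabla)$. A tilting module is basic if it is a direct sum of pairwise non-isomorphic indecomposable tilting modules. Simple preserving duality: an exact, involutive, contravariant equivalence $A\text{-mod}\to A\text{-mod}$ which preserves the isomorphism classes of simple modules. The notation $A=\operatorname{End}_{\operatorname{End}_A(T)}(T)$ means that the canonical algebra homomorphism $A\to\operatorname{End}_{\operatorname{End}_A(T)}(T)$ is an isomorphism. *)

(* Defs.v *)
From HB Require Import structures.
From mathcomp Require Import all_boot all_order all_algebra all_field.

Set Implicit Arguments.
Unset Strict Implicit.
Unset Printing Implicit Defensive.

Import Order.TTheory GRing.Theory.
Local Open Scope ring_scope.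

(* A left A-module is a finite dimensional K-space with a unital algebra
   homomorphism from A to its K-endomorphisms. The zero space is allowed, so
   'End(V) carries no ring structure here and composition is written out. *)
Record amod (K : fieldType) (A : falgType K) := AMod {
  amod_sort :> vectType K;
  act : {linear A -> 'End(amod_sort)};
  act1 : act 1 = \1%VF;
  actM : forall a b, act (a * b) = (act a \o act b)%VF }.
Arguments act {K A} M : rename.

Section BuildModule.
Variables (K : fieldType) (A : falgType K) (V : vectType K) (rho : A -> V -> V).
Hypothesis rho_linr : forall a, linear (rho a).
Hypothesis rho_linl : forall v, linear (rho^~ v).
Hypothesis rho1 : forall v, rho 1 v = v.
Hypothesis rhoM : forall a b v, rho (a * b) v = rho a (rho b v).

Definition rho_linear a : {linear V -> V} :=
  HB.pack (rho a) (GRing.isLinear.Build K V V *:%R (rho a) (rho_linr a)).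

Definition rho_end a : 'End(V) := linfun (rho_linear a).

Lemma rho_endE a v : rho_end a v = rho a v.
Proof. by rewrite lfunE. Qed.

Lemma rho_end_linear : linear rho_end.
Proof.
move=> k a b; apply/lfunP=> v; rewrite add_lfunE scale_lfunE !rho_endE.
exact: rho_linl.
Qed.

Definition rho_act : {linear A -> 'End(V)} :=
  HB.pack rho_end (GRing.isLinear.Build K A 'End(V) *:%R rho_end rho_end_linear).

Lemma rho_act1 : rho_act 1 = \1%VF.
Proof. by apply/lfunP=> v; rewrite rho_endE rho1 id_lfunE. Qed.

Lemma rho_actM a b : rho_act (a * b) = (rho_act a \o rho_act b)%VF.
Proof. by apply/lfunP=> v; rewrite comp_lfunE !rho_endE rhoM. Qed.

Definition mk_amod : amod A := AMod rho_act1 rho_actM.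

Lemma mk_amodE a (v : V) : act mk_amod a v = rho a v.
Proof. exact: rho_endE. Qed.

End BuildModule.

Section Intertwiners.
Variables (K : fieldType) (R V W : vectType K).
Variables (rV : {linear R -> 'End(V)}) (rW : {linear R -> 'End(W)}).

Definition defect (r : R) (f : 'Hom(V, W)) : 'Hom(V, W) :=
  ((f \o rV r) - (rW r \o f))%VF.

Lemma defect_linear r : linear (defect r).
Proof.
move=> k f g; apply/lfunP=> v; rewrite /defect.
rewrite !(add_lfunE, opp_lfunE, comp_lfunE, scale_lfunE) linearP scalerBr.
by rewrite opprD addrACA.
Qed.

Definition defect_lin r : {linear 'Hom(V, W) -> 'Hom(V, W)} :=
  HB.pack (defect r)
    (GRing.isLinear.Build K 'Hom(V, W) 'Hom(V, W) *:%R _ (defect_linear r)).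

(* The K-linear maps V -> W commuting with the actions of R; see [intwP]. *)
Definition intw : {vspace 'Hom(V, W)} :=
  (\bigcap_(i < \dim {:R}) lker (linfun (defect_lin (vbasis {:R})`_i)))%VS.

Lemma intwP (f : 'Hom(V, W)) :
  reflect (forall r, f \o rV r = rW r \o f)%VF (f \in intw).
Proof.
apply: (iffP idP) => [fI r | fC]; last first.
  rewrite memvE; apply/subv_bigcapP=> i _; rewrite -memvE memv_ker lfunE /=.
  by rewrite /defect fC subrr.
have fi (i : 'I_(\dim {:R})) : defect (vbasis {:R})`_i f = 0.
  move: fI; rewrite memvE => /subv_bigcapP/(_ i isT).
  by rewrite -memvE memv_ker lfunE /= => /eqP.
apply/lfunP=> v; rewrite !comp_lfunE (coord_vbasis (memvf r)) !linear_sum /=.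
rewrite !sum_lfunE linear_sum /=; apply: eq_bigr => i _.
rewrite !linearZ /= !scale_lfunE linearZ /=; congr (_ *: _).
move/lfunP/(_ v): (fi i).
rewrite !(add_lfunE, opp_lfunE, comp_lfunE, zero_lfunE).
by move/eqP; rewrite subr_eq0 => /eqP.
Qed.

End Intertwiners.

Section Modules.
Variables (K : fieldType) (A : falgType K).
Implicit Types M N Q : amod A.

Definition homA M N : {vspace 'Hom(M, N)} := intw (act M) (act N).

Definition iso M N : Prop := exists2 f : 'Hom(M, N), f \in homA M N & bijective f.

Lemma homAE M N (f : 'Hom(M, N)) a v :
  f \in homA M N -> f (act M a v) = act N a (f v).
Proof. by move/intwP/(_ a)/lfunP/(_ v); rewrite !comp_lfunE. Qed.

Definition zero_module M : Prop := {:M}%VS = 0%VS.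

Record submod M := SubMod {
  sub_space :> {vspace M};
  sub_stable : forall a, (act M a @: sub_space <= sub_space)%VS }.

Lemma stableP M (U : submod M) a v : v \in (U : {vspace M}) -> act M a v \in (U : {vspace M}).
Proof. by move=> Uv; apply: (subvP (sub_stable U a)); apply: memv_img. Qed.

Section SubQuotient.
Variables (M : amod A) (U : submod M).

Definition sub_rho a (x : subvs_of U) : subvs_of U := vsproj U (act M a (vsval x)).

Fact sub_rho_linr a : linear (sub_rho a).
Proof. by move=> k x y; rewrite /sub_rho !linearP. Qed.

Fact sub_rho_linl x : linear (sub_rho^~ x).
Proof. by move=> k a b; rewrite /sub_rho linearP add_lfunE scale_lfunE linearP. Qed.

Fact sub_rho1 x : sub_rho 1 x = x.
Proof. by rewrite /sub_rho act1 id_lfunE vsvalK. Qed.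

Fact sub_rhoM a b x : sub_rho (a * b) x = sub_rho a (sub_rho b x).
Proof.
by rewrite /sub_rho vsprojK ?actM ?comp_lfunE //; apply/stableP/subvsP.
Qed.

Definition sub_mod : amod A := mk_amod sub_rho_linr sub_rho_linl sub_rho1 sub_rhoM.

(* The quotient M / U lives on the complement of U, with [quot_proj] the
   projection along U; [quot_proj_ker], [quot_proj_onto] and [quot_proj_hom]
   show that this is the usual quotient module. *)
Definition quot_proj (v : M) : subvs_of U^C := vsproj U^C (v - projv U v).

Fact quot_proj_linear : linear quot_proj.
Proof.
by move=> k x y; rewrite /quot_proj -linearP scalerBr linearP opprD addrACA.
Qed.

Definition quot_proj_lin : {linear M -> subvs_of U^C} :=
  HB.pack quot_proj
    (GRing.isLinear.Build K M (subvs_of U^C) *:%R quot_proj quot_proj_linear).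

Fact quot_proj_ker v : (quot_proj v == 0) = (v \in (U : {vspace M})).
Proof.
apply/eqP/idP => [/(congr1 vsval) | Uv]; last first.
  by rewrite /quot_proj projv_id // subrr linear0.
rewrite vsprojK ?memv_projC // linear0 => /eqP; rewrite subr_eq0 => /eqP ->.
exact: memv_proj.
Qed.

Fact quot_projK x : quot_proj (vsval x) = x.
Proof.
apply: val_inj; rewrite /= vsprojK ?memv_projC //.
suff /eqP-> : projv U (vsval x) == 0 by rewrite subr0.
by rewrite -memv_ker lker_proj subvsP.
Qed.

Definition quot_rho a (x : subvs_of U^C) : subvs_of U^C :=
  quot_proj (act M a (vsval x)).

Fact quot_rho_linr a : linear (quot_rho a).
Proof. by move=> k x y; rewrite /quot_rho !linearP /= quot_proj_linear. Qed.

Fact quot_rho_linl x : linear (quot_rho^~ x).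
Proof.
by move=> k a b; rewrite /quot_rho linearP add_lfunE scale_lfunE quot_proj_linear.
Qed.

Fact quot_rho1 x : quot_rho 1 x = x.
Proof. by rewrite /quot_rho act1 id_lfunE quot_projK. Qed.

Fact quot_rho_proj a v : quot_rho a (quot_proj v) = quot_proj (act M a v).
Proof.
have projB x y : quot_proj x - quot_proj y = quot_proj (x - y).
  exact: esym (linearB quot_proj_lin x y).
apply/eqP; rewrite -subr_eq0 /quot_rho projB quot_proj_ker -linearB.
by apply: stableP; rewrite -quot_proj_ker -projB quot_projK subrr.
Qed.

Fact quot_rhoM a b x : quot_rho (a * b) x = quot_rho a (quot_rho b x).
Proof. by rewrite {3}/quot_rho quot_rho_proj /quot_rho actM comp_lfunE. Qed.

Definition quot_mod : amod A :=
  mk_amod quot_rho_linr quot_rho_linl quot_rho1 quot_rhoM.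

Definition quot_hom : 'Hom(M, quot_mod) := linfun quot_proj_lin.

Lemma quot_proj_hom : quot_hom \in homA M quot_mod.
Proof.
apply/intwP=> a; apply/lfunP=> v.
rewrite !comp_lfunE mk_amodE /quot_hom !(@lfunE _ M (subvs_of U^C)) /=.
by rewrite quot_rho_proj.
Qed.

Lemma quot_proj_onto : limg quot_hom = fullv.
Proof.
apply/eqP; rewrite eqEsubv subvf; apply/subvP=> x _.
by rewrite -(quot_projK x) -[quot_proj _](lfunE quot_proj_lin) memv_img ?memvf.
Qed.

End SubQuotient.

Lemma ker_stable M N (f : 'Hom(M, N)) (hf : f \in homA M N) a :
  (act M a @: lker f <= lker f)%VS.
Proof.
apply/subvP=> _ /memv_imgP[v kv ->]; move: kv; rewrite !memv_ker => /eqP kv.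
by rewrite (homAE _ _ hf) kv linear0.
Qed.

Definition ker_sub M N (f : 'Hom(M, N)) (hf : f \in homA M N) : submod M :=
  SubMod (ker_stable hf).

Section DirectSum.
Variables M N : amod A.

Definition dsum_rho a (x : M * N) : M * N := (act M a x.1, act N a x.2).

Fact dsum_rho_linr a : linear (dsum_rho a).
Proof. by move=> k x y; rewrite /dsum_rho !linearP. Qed.

Fact dsum_rho_linl x : linear (dsum_rho^~ x).
Proof.
by move=> k a b; rewrite /dsum_rho !linearP !add_lfunE !scale_lfunE.
Qed.

Fact dsum_rho1 x : dsum_rho 1 x = x.
Proof. by case: x => x y; rewrite /dsum_rho !act1 !id_lfunE. Qed.

Fact dsum_rhoM a b x : dsum_rho (a * b) x = dsum_rho a (dsum_rho b x).
Proof. by rewrite /dsum_rho !actM !comp_lfunE. Qed.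

Definition dsum : amod A :=
  mk_amod dsum_rho_linr dsum_rho_linl dsum_rho1 dsum_rhoM.

End DirectSum.

Section ZeroModule.

Definition mod0_rho (a : A) (x : 'rV[K]_0) : 'rV[K]_0 := x.

Fact mod0_rho_linr a : linear (mod0_rho a). Proof. by []. Qed.

Fact mod0_rho_linl x : linear (mod0_rho^~ x).
Proof. by move=> k a b; rewrite [LHS]thinmx0 [RHS]thinmx0. Qed.

Fact mod0_rho1 x : mod0_rho 1 x = x. Proof. by []. Qed.

Fact mod0_rhoM a b x : mod0_rho (a * b) x = mod0_rho a (mod0_rho b x).
Proof. by []. Qed.

Definition mod0 : amod A :=
  mk_amod mod0_rho_linr mod0_rho_linl mod0_rho1 mod0_rhoM.

End ZeroModule.

(* It suffices to sum the images of a basis of Hom_A(M, N): [trace_sup] and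
   [trace_least] identify the result with the sum of all the images. *)
Definition trace_space M N : {vspace N} :=
  (\sum_(i < \dim (homA M N)) limg (vbasis (homA M N))`_i)%VS.

Lemma trace_sup M N (f : 'Hom(M, N)) :
  f \in homA M N -> (limg f <= trace_space M N)%VS.
Proof.
move=> hf; apply/subvP=> _ /memv_imgP[v _ ->].
rewrite (coord_vbasis hf) sum_lfunE; apply: memv_suml => i _.
rewrite scale_lfunE memvZ //; apply: (subvP (sumv_sup i _ (subvv _))) => //.
by rewrite memv_img ?memvf.
Qed.

Lemma trace_least M N (W : {vspace N}) :
  (forall f, f \in homA M N -> limg f <= W)%VS -> (trace_space M N <= W)%VS.
Proof.
move=> hW; apply/subv_sumP=> i _; apply: hW; apply: vbasis_mem.
by rewrite mem_nth // size_tuple.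
Qed.

Lemma trace_stable M N a : (act N a @: trace_space M N <= trace_space M N)%VS.
Proof.
rewrite limg_sum; apply/subv_sumP=> i _.
have hi : (vbasis (homA M N))`_i \in homA M N.
  by apply: vbasis_mem; rewrite mem_nth // size_tuple.
apply/subvP=> _ /memv_imgP[_ /memv_imgP[v _ ->] ->]; rewrite -(homAE _ _ hi).
by apply: (subvP (trace_sup hi)); rewrite memv_img ?memvf.
Qed.

Definition trace M N : submod N := SubMod (@trace_stable M N).

Definition simple M : Prop :=
  ~ zero_module M /\
  forall U : submod M, U = 0%VS :> {vspace M} \/ U = fullv :> {vspace M}.

Definition indecomposable M : Prop :=
  ~ zero_module M /\
  forall N Q, iso M (dsum N Q) -> zero_module N \/ zero_module Q.

Definition direct_summand N M : Prop := exists Q, iso M (dsum N Q).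

Definition faithful M : Prop := forall a, act M a = 0 -> a = 0.

Definition projective M : Prop :=
  forall N Q (g : 'Hom(N, Q)) (f : 'Hom(M, Q)),
    g \in homA N Q -> limg g = fullv -> f \in homA M Q ->
  exists2 h, h \in homA M N & (g \o h)%VF = f.

Definition injective_mod M : Prop :=
  forall N Q (g : 'Hom(N, Q)) (f : 'Hom(N, M)),
    g \in homA N Q -> lker g = 0%VS -> f \in homA N M ->
  exists2 h, h \in homA Q M & (h \o g)%VF = f.

Definition projective_cover P M : Prop :=
  projective P /\
  exists2 p : 'Hom(P, M), p \in homA P M & limg p = fullv /\
    forall U : submod P, (U + lker p)%VS = fullv -> U = fullv :> {vspace P}.

Definition injective_hull I M : Prop :=
  injective_mod I /\
  exists2 i : 'Hom(M, I), i \in homA M I & lker i = 0%VS /\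
    forall U : submod I, (U :&: limg i)%VS = 0%VS -> U = 0%VS :> {vspace I}.

Definition complete_simples (Lam : Type) (L : Lam -> amod A) : Prop :=
  [/\ forall lam, simple (L lam),
      forall lam mu, iso (L lam) (L mu) -> lam = mu
    & forall S, simple S -> exists lam, iso S (L lam)].

Definition split_simples (Lam : Type) (L : Lam -> amod A) : Prop :=
  forall lam, homA (L lam) (L lam) = <[\1%VF]>%VS.

(* [filtration X M s] : M has a filtration whose subquotients, read from the
   top down, are isomorphic to the X mu for mu in the list s. *)
Inductive filtration (Lam : Type) (X : Lam -> amod A) :
    amod A -> seq Lam -> Prop :=
  | Filt0 M : zero_module M -> filtration X M [::]
  | FiltS M (U : submod M) mu s :
      filtration X (sub_mod U) s -> iso (quot_mod U) (X mu) ->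
      filtration X M (mu :: s).

Definition has_filtration (Lam : Type) (X : Lam -> amod A) M : Prop :=
  exists s, filtration X M s.

Definition has_filtration_in (Lam : Type) (X : Lam -> amod A) (p : pred Lam) M :=
  exists2 s, filtration X M s & all p s.

(* When the L mu are simple, [filtration L M s] says that s lists the factors of
   a composition series of M. *)
Definition composition_factor (Lam : eqType) (L : Lam -> amod A) mu M : Prop :=
  exists2 s, filtration L M s & mu \in s.

(* Morphisms of the module category are the K-linear maps in [homA], so the
   values of [cof_map] outside of [homA] are irrelevant. *)
Record cofunctor := Cofunctor {
  cof_obj :> amod A -> amod A;
  cof_map : forall M N, 'Hom(M, N) -> 'Hom(cof_obj N, cof_obj M);
  cof_hom : forall M N (f : 'Hom(M, N)),
    f \in homA M N -> cof_map f \in homA (cof_obj N) (cof_obj M);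
  cof_id : forall M, @cof_map M M \1%VF = \1%VF;
  cof_comp : forall M N Q (f : 'Hom(M, N)) (g : 'Hom(N, Q)),
    f \in homA M N -> g \in homA N Q ->
    cof_map (g \o f)%VF = (cof_map f \o cof_map g)%VF }.

Definition short_exact M N Q (f : 'Hom(M, N)) (g : 'Hom(N, Q)) : Prop :=
  [/\ lker f = 0%VS, limg f = lker g & limg g = fullv].

(* Only additivity is required: K-linearity on morphisms is not assumed. *)
Definition exact_cofunctor (D : cofunctor) : Prop :=
  (forall M N (f g : 'Hom(M, N)), f \in homA M N -> g \in homA M N ->
     cof_map D (f + g) = cof_map D f + cof_map D g) /\
  (forall M N Q (f : 'Hom(M, N)) (g : 'Hom(N, Q)),
     f \in homA M N -> g \in homA N Q ->
     short_exact f g -> short_exact (cof_map D g) (cof_map D f)).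

Definition nat_iso_id (G D : cofunctor) : Prop :=
  exists eta : forall M, 'Hom(M, G (D M)),
    (forall M, eta M \in homA M (G (D M)) /\ bijective (eta M)) /\
    (forall M N (f : 'Hom(M, N)), f \in homA M N ->
       (cof_map G (cof_map D f) \o eta M = eta N \o f)%VF).

Definition equivalence (D : cofunctor) : Prop :=
  exists G : cofunctor, nat_iso_id G D /\ nat_iso_id D G.

(* [nat_iso_id D D] expresses involutivity, up to natural isomorphism. *)
Definition simple_preserving_duality (D : cofunctor) : Prop :=
  [/\ exact_cofunctor D, nat_iso_id D D, equivalence D
    & forall S, simple S -> iso (D S) S].

Section DoubleCentralizer.
Variable T : amod A.

Definition endA := subvs_of (homA T T).

Definition endA_act : {linear endA -> 'End(T)} := vsval.

(* End_{End_A(T)}(T): the algebra End_A(T) contains the scalars, so that additive maps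
   commuting with it are K-linear. *)
Definition end_endA : {vspace 'End(T)} := intw endA_act endA_act.

Fact act_end_endA a : act T a \in end_endA.
Proof.
by apply/intwP=> -[f hf] /=; move/intwP: hf => ->.
Qed.

Definition canonical_map (a : A) : subvs_of end_endA := Subvs (act_end_endA a).

Definition double_centralizer : Prop := bijective canonical_map.

End DoubleCentralizer.

Section QuasiHereditary.
Variables (d : Order.disp_t) (Lam : finPOrderType d).
Variables (L P I : Lam -> amod A).

Definition standard_sub (lam : Lam) : submod (P lam) :=
  trace (\big[dsum/mod0]_(mu | (lam < mu)%O) P mu) (P lam).

Definition standard (lam : Lam) : amod A := quot_mod (standard_sub lam).

(* The surjection of standard lam onto L lam is induced by that of P lam, and its
   kernel does not depend on the choice of f. *)
Definition quasi_hereditary : Prop :=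
  forall lam,
    has_filtration_in standard (fun mu => (lam < mu)%O)
      (sub_mod (standard_sub lam)) /\
    exists (f : 'Hom(standard lam, L lam)) (hf : f \in homA (standard lam) (L lam)),
      limg f = fullv /\
      has_filtration_in L (fun mu => (mu < lam)%O) (sub_mod (ker_sub hf)).

Definition costandard_sub (lam : Lam) (U : submod (I lam)) : Prop :=
  (forall mu, (lam < mu)%O -> ~ composition_factor L mu (sub_mod U)) /\
  (forall V : submod (I lam),
     (forall mu, (lam < mu)%O -> ~ composition_factor L mu (sub_mod V)) ->
     (V <= U)%VS).

Definition tilting (nabla : forall lam, submod (I lam)) (T : amod A) : Prop :=
  has_filtration standard T /\ has_filtration (fun lam => sub_mod (nabla lam)) T.

Definition basic_tilting (nabla : forall lam, submod (I lam)) (T : amod A) : Prop :=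
  tilting nabla T /\
  exists (n : nat) (X : 'I_n -> amod A),
    [/\ forall i, indecomposable (X i) /\ tilting nabla (X i),
        forall i j, iso (X i) (X j) -> i = j
      & iso T (\big[dsum/mod0]_(i < n) X i)].

End QuasiHereditary.

End Modules.

(* Main.v *)
Require Import Defs.
From Stdlib Require Import Classical.
From Stdlib Require List.
From HB Require Import structures.
From mathcomp Require Import all_boot all_order all_algebra all_field.

Set Implicit Arguments.
Unset Strict Implicit.
Unset Printing Implicit Defensive.

Import Order.TTheory GRing.Theory.
Local Open Scope ring_scope.

(* Embed A into a tilting module T0 with cokernel C in F(Delta), let t0 be the image of 1, and
   embed C into a tilting module T1.  Since Ext^1(F(Delta), F(nabla)) = 0, every element x of
   every tilting module X is phi(t0) for some phi : T0 -> X, and A t0 is the kernel of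
   T0 -> T1.  Take T0 of minimal dimension: then an endomorphism of T0 fixing t0 is bijective.

   Indecomposable tilting modules are determined by a highest weight, so the duality D fixes
   every tilting module up to isomorphism and exchanges "T generates X" with "T cogenerates
   X".  As T0 generates all tilting modules, it also cogenerates them.

   Let T' be a faithful tilting module.  If T' did not cogenerate T0, the nonzero
   End(T0)-submodule of T0 killed by all maps to T' would contain z <> 0 killed by the
   annihilator {h | h t0 = 0} of t0, because by minimality this left ideal lies in the radical
   of End(T0).  Cogenerating T1 by T0 gives z = a t0 with a <> 0, and a kills T' because every
   element of T' is an image of t0: a contradiction.  So T' cogenerates and, dually, generates
   T0; writing t0 as a sum of images of elements of T' shows that T0 is in add T'.
   Conversely, if T0 is in add T then f in End_{End(T)}(T) induces a map of T0 whose value at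
   t0 is killed by T0 -> T1, hence is a t0 for some a, and f is the action of a.  The minimal
   T is the sum of the distinct indecomposable summands of T0. *)

(** * Homomorphisms and direct sums *)

Section Homs.
Variables (K : fieldType) (A : falgType K).
Implicit Types M N Q X Y Z : amod A.

Lemma homP M N (f : 'Hom(M, N)) :
  (forall a v, f (act M a v) = act N a (f v)) -> f \in homA M N.
Proof. by move=> fE; apply/intwP=> a; apply/lfunP=> v; rewrite !comp_lfunE fE. Qed.

Lemma hom_id M : \1%VF \in homA M M.
Proof. by apply: homP => a v; rewrite !id_lfunE. Qed.

Lemma hom_comp M N Q (f : 'Hom(M, N)) (g : 'Hom(N, Q)) :
  f \in homA M N -> g \in homA N Q -> (g \o f)%VF \in homA M Q.
Proof.
by move=> hf hg; apply: homP => a v; rewrite !comp_lfunE (homAE _ _ hf) (homAE _ _ hg).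
Qed.

Lemma compE M N Q (f : 'Hom(M, N)) (g : 'Hom(N, Q)) h :
  (g \o f)%VF = h -> forall x, g (f x) = h x.
Proof. by move=> <- x; rewrite comp_lfunE. Qed.

(** The linear section [q^-1] need not commute with [A], but [f \o q^-1] does, because [f] does not
    see the choice of a preimage. *)
Lemma factor_surj M N Q (q : 'Hom(M, Q)) (f : 'Hom(M, N)) :
  q \in homA M Q -> f \in homA M N -> (forall z, exists y, q y = z) ->
  (forall x, q x = 0 -> f x = 0) -> exists2 h, h \in homA Q N & (h \o q)%VF = f.
Proof.
move=> hq hf sq kf; have qK z : q ((q^-1)%VF z) = z.
  by case: (sq z) => y <-; apply: limg_lfunVK; rewrite memv_img ?memvf.
have E x : f ((q^-1)%VF (q x)) = f x.
  by apply/eqP; rewrite -subr_eq0 -linearB; apply/eqP/kf; rewrite linearB /= qK subrr.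
exists (f \o q^-1)%VF; last by apply/lfunP=> x; rewrite !comp_lfunE E.
apply: homP => a z; case: (sq z) => y <-.
by rewrite !comp_lfunE -(homAE _ _ hq) !E (homAE _ _ hf).
Qed.

Lemma factor_inj M N Q (i : 'Hom(M, N)) (f : 'Hom(Q, N)) :
  i \in homA M N -> f \in homA Q N -> (forall x, i x = 0 -> x = 0) ->
  (forall x, exists y, f x = i y) -> exists2 h, h \in homA Q M & (i \o h)%VF = f.
Proof.
move=> hi hf ii fi; have iI x y : i x = i y -> x = y.
  by move/eqP; rewrite -subr_eq0 -linearB => /eqP/ii/eqP; rewrite subr_eq0 => /eqP.
have E x : i ((i^-1)%VF (f x)) = f x.
  by case: (fi x) => y ->; apply: limg_lfunVK; rewrite memv_img ?memvf.
exists (i^-1 \o f)%VF; last by apply/lfunP=> x; rewrite !comp_lfunE E.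
by apply: homP => a z; apply: iI; rewrite (homAE _ _ hi) !comp_lfunE !E (homAE _ _ hf).
Qed.

Lemma lker_inj M N (f : 'Hom(M, N)) :
  lker f = 0%VS <-> (forall x, f x = 0 -> x = 0).
Proof.
split=> [k0 x fx | fi]; first by apply/eqP; rewrite -memv0 -k0 memv_ker fx.
by apply/eqP; rewrite -subv0; apply/subvP=> x; rewrite memv_ker memv0 => /eqP/fi->.
Qed.

Lemma limg_surj M N (f : 'Hom(M, N)) :
  limg f = fullv <-> (forall z, exists y, f y = z).
Proof.
split=> [fs z | fs].
  by have /memv_imgP[y _ ->] : z \in limg f; [rewrite fs memvf | exists y].
apply/eqP; rewrite eqEsubv subvf; apply/subvP=> z _.
by case: (fs z) => y <-; rewrite memv_img ?memvf.
Qed.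

Lemma inj_eq0 M N (f : 'Hom(M, N)) x y :
  (forall x, f x = 0 -> x = 0) -> f x = f y -> x = y.
Proof.
by move=> fi /eqP; rewrite -subr_eq0 -linearB => /eqP/fi/eqP; rewrite subr_eq0 => /eqP.
Qed.

Lemma bij_hom M N (f : 'Hom(M, N)) :
  f \in homA M N -> (forall x, f x = 0 -> x = 0) -> (forall z, exists y, f y = z) ->
  exists g, [/\ g \in homA N M, (g \o f)%VF = \1%VF & (f \o g)%VF = \1%VF].
Proof.
move=> hf fi fs.
have [x|g hg gE] := factor_inj hf (hom_id N) fi.
  by have [y <-] := fs x; exists y; rewrite id_lfunE.
exists g; split=> //; apply/lfunP=> x; rewrite comp_lfunE id_lfunE.
by apply: (inj_eq0 fi); rewrite (compE gE) id_lfunE.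
Qed.

Lemma bij_injsurj M N (f : 'Hom(M, N)) :
  bijective f -> (forall x, f x = 0 -> x = 0) /\ (forall z, exists y, f y = z).
Proof.
case=> g fK gK; split=> [x fx|z]; last by exists (g z); rewrite gK.
by rewrite -(fK x) fx -(linear0 f) fK.
Qed.

Lemma isoP M N : iso M N <->
  exists f g, [/\ f \in homA M N, g \in homA N M, (g \o f)%VF = \1%VF
                & (f \o g)%VF = \1%VF].
Proof.
split=> [[f hf /bij_injsurj[fi fs]]|[f [g [hf hg gf fg]]]].
  by have [g [hg gf fg]] := bij_hom hf fi fs; exists f, g.
exists f => //; exists g => x.
  by rewrite (compE gf) id_lfunE.
by rewrite (compE fg) id_lfunE.
Qed.

Lemma iso_refl M : iso M M.
Proof. by apply/isoP; exists \1%VF, \1%VF; rewrite comp_lfun1l hom_id. Qed.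

Lemma iso_sym M N : iso M N -> iso N M.
Proof. by move/isoP=> [f [g []]] *; apply/isoP; exists g, f. Qed.

Lemma iso_trans M N Q : iso M N -> iso N Q -> iso M Q.
Proof.
move=> /isoP[f [g [hf hg gf fg]]] /isoP[f' [g' [hf' hg' gf' fg']]].
apply/isoP; exists (f' \o f)%VF, (g \o g')%VF; split; try exact: hom_comp.
  by rewrite -comp_lfunA (comp_lfunA g') gf' comp_lfun1l.
by rewrite -comp_lfunA (comp_lfunA f) fg comp_lfun1l.
Qed.

Lemma zeroP M : zero_module M <-> forall x : M, x = 0.
Proof.
split=> [M0 x|M0]; first by apply/eqP; rewrite -memv0 -M0 memvf.
by apply/eqP; rewrite -subv0; apply/subvP=> x _; rewrite (M0 x) mem0v.
Qed.

Lemma nonzeroP M : ~ zero_module M -> exists x : M, x <> 0.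
Proof. by move=> /zeroP/not_all_ex_not. Qed.

(** Short exactness of [A]-linear maps in terms of elements; [sesP] compares it with
    [short_exact]. *)
Record ses M N Q (i : 'Hom(M, N)) (q : 'Hom(N, Q)) : Prop := Ses {
  ses_i : i \in homA M N;
  ses_q : q \in homA N Q;
  ses_inj : forall x, i x = 0 -> x = 0;
  ses_surj : forall z, exists y, q y = z;
  ses_comp : forall x, q (i x) = 0;
  ses_ker : forall y, q y = 0 -> exists x, y = i x }.

Lemma sesP M N Q (i : 'Hom(M, N)) (q : 'Hom(N, Q)) :
  ses i q <-> [/\ i \in homA M N, q \in homA N Q & short_exact i q].
Proof.
split=> [[hi hq ii qs qi kq]|[hi hq [/lker_inj ii E /limg_surj qs]]].
  split=> //; split; [exact/lker_inj| |exact/limg_surj].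
  apply/eqP; rewrite eqEsubv; apply/andP; split; apply/subvP=> y.
    by case/memv_imgP=> x _ ->; rewrite memv_ker qi.
  by rewrite memv_ker => /eqP/kq[x ->]; rewrite memv_img ?memvf.
split=> // [x|y qy].
  by apply/eqP; rewrite -memv_ker -E memv_img ?memvf.
have : y \in limg i by rewrite E memv_ker qy.
by case/memv_imgP=> x _ ->; exists x.
Qed.

Definition sub_incl M (U : submod M) : 'Hom(sub_mod U, M) :=
  linfun (vsval : subvs_of U -> M).

Lemma sub_inclE M (U : submod M) x : sub_incl U x = vsval x.
Proof. exact: (@lfunE _ (subvs_of U) M). Qed.

Lemma hom_incl M (U : submod M) : sub_incl U \in homA (sub_mod U) M.
Proof.
apply: homP => a v; rewrite !sub_inclE mk_amodE /= /sub_rho vsprojK //.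
exact/stableP/subvsP.
Qed.

Lemma sub_incl_mem M (U : submod M) v :
  v \in (U : {vspace M}) -> exists x, v = sub_incl U x.
Proof. by move=> Uv; exists (vsproj U v); rewrite sub_inclE vsprojK. Qed.

Lemma ses_sub M (U : submod M) : ses (sub_incl U) (quot_hom U).
Proof.
have qE v : quot_hom U v = quot_proj U v by rewrite [LHS](lfunE (quot_proj_lin U)).
split; [exact: hom_incl|exact: quot_proj_hom| | | |].
- by move=> x; rewrite sub_inclE => x0; apply: val_inj; rewrite /= x0.
- by apply/limg_surj; exact: quot_proj_onto.
- by move=> x; apply/eqP; rewrite qE quot_proj_ker sub_inclE; apply: subvsP.
- by move=> y /eqP; rewrite qE quot_proj_ker => /sub_incl_mem.
Qed.

Lemma ses_kernel M N (f : 'Hom(M, N)) (hf : f \in homA M N) :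
  (forall z, exists y, f y = z) -> ses (sub_incl (ker_sub hf)) f.
Proof.
move=> fs; split=> //; first exact: hom_incl.
- exact: (ses_inj (ses_sub _)).
- by move=> x; apply/eqP; rewrite -memv_ker sub_inclE; apply: (@subvsP _ _ (ker_sub hf)).
- by move=> y fy; apply: (sub_incl_mem (U := ker_sub hf)); rewrite /= memv_ker fy.
Qed.

Lemma img_stable M N (f : 'Hom(M, N)) (hf : f \in homA M N) a :
  (act N a @: limg f <= limg f)%VS.
Proof.
apply/subvP=> _ /memv_imgP[_ /memv_imgP[v _ ->] ->].
by rewrite -(homAE _ _ hf) memv_img ?memvf.
Qed.

Definition img_sub M N (f : 'Hom(M, N)) (hf : f \in homA M N) : submod N :=
  SubMod (img_stable hf).

Lemma ses_coker M N (f : 'Hom(M, N)) (hf : f \in homA M N) :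
  (forall x, f x = 0 -> x = 0) -> ses f (quot_hom (img_sub hf)).
Proof.
have [_ hq _ qs qi qk] := ses_sub (img_sub hf).
move=> fi; split=> // [x | y /qk[x ->]].
  have fx : f x \in (img_sub hf : {vspace N}) by rewrite /= memv_img ?memvf.
  by have [y ->] := sub_incl_mem fx.
rewrite sub_inclE; have /memv_imgP[z _ ->] := subvsP x.
by exists z.
Qed.

Lemma ses_dim M N Q (i : 'Hom(M, N)) (q : 'Hom(N, Q)) :
  ses i q -> (\dim {:M} + \dim {:Q} = \dim {:N})%N.
Proof.
case/sesP=> [_ _ [ki E qs]].
have H1 := limg_ker_dim q fullv; have H2 := limg_ker_dim i fullv.
rewrite qs capfv -E in H1; rewrite ki capv0 dimv0 add0n in H2.
by rewrite -H1 H2.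
Qed.

Lemma inj_dim M N (f : 'Hom(M, N)) :
  (forall x, f x = 0 -> x = 0) -> (\dim {:M} <= \dim {:N})%N.
Proof.
move=> /lker_inj kf; have := limg_ker_dim f fullv.
by rewrite kf capv0 dimv0 add0n => <-; apply/dimvS/subvf.
Qed.

Lemma inj_dim_surj M N (f : 'Hom(M, N)) :
  (forall x, f x = 0 -> x = 0) -> (\dim {:N} <= \dim {:M})%N ->
  forall z, exists y, f y = z.
Proof.
move=> /lker_inj kf leNM; apply/limg_surj/eqP.
have := limg_ker_dim f fullv; rewrite kf capv0 dimv0 add0n => E.
by rewrite eqEdim subvf E.
Qed.

Lemma iso_dim M N : iso M N -> \dim {:M} = \dim {:N}.
Proof.
move=> iMN; have [f hf /bij_injsurj[fi _]] := iMN.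
have [g hg /bij_injsurj[gi _]] := iso_sym iMN.
by apply/eqP; rewrite eqn_leq (inj_dim fi) (inj_dim gi).
Qed.

Lemma zero_dim M : zero_module M <-> \dim {:M} = 0%N.
Proof. by rewrite /zero_module; split=> [->|/eqP]; rewrite ?dimv0 ?dimv_eq0 // => /eqP. Qed.

Lemma zero_iso M N : iso M N -> zero_module M -> zero_module N.
Proof. by move=> /iso_dim E; rewrite !zero_dim E. Qed.

Lemma ses_iso_sub M M' N Q (i : 'Hom(M, N)) (i' : 'Hom(M', N)) (q : 'Hom(N, Q)) :
  ses i q -> ses i' q -> iso M M'.
Proof.
move=> s s'.
have [f hf fE] : exists2 f, f \in homA M M' & (i' \o f)%VF = i.
  apply: factor_inj (ses_i s') (ses_i s) (ses_inj s') _ => x.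
  exact/(ses_ker s')/(ses_comp s).
exists f => //; have fi x : f x = 0 -> x = 0.
  by move=> fx; apply: (ses_inj s); rewrite -(compE fE) fx linear0.
have fs z : exists y, f y = z.
  have [y yE] := ses_ker s (ses_comp s' z); exists y; apply: (inj_eq0 (ses_inj s')).
  by rewrite (compE fE).
have [g [hg gf fg]] := bij_hom hf fi fs.
by exists g => x; rewrite ?(compE gf) ?(compE fg) id_lfunE.
Qed.

Lemma bij_iso M N (f : 'Hom(M, N)) :
  f \in homA M N -> (forall x, f x = 0 -> x = 0) -> (forall z, exists y, f y = z) ->
  iso M N.
Proof.
by move=> hf fi fs; have [g []] := bij_hom hf fi fs; move=> *; apply/isoP; exists f, g.
Qed.

Lemma ses_iso_quot M N Q Q' (i : 'Hom(M, N)) (q : 'Hom(N, Q)) (q' : 'Hom(N, Q')) :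
  ses i q -> ses i q' -> iso Q Q'.
Proof.
move=> s s'.
have [f hf fE] : exists2 f, f \in homA Q Q' & (f \o q)%VF = q'.
  apply: factor_surj (ses_q s) (ses_q s') (ses_surj s) _ => x.
  by case/(ses_ker s) => y ->; apply: ses_comp s' _.
apply: (bij_iso hf) => [x fx|z].
  have [y yE] := ses_surj s x; move: fx; rewrite -yE (compE fE).
  by case/(ses_ker s') => w ->; apply: ses_comp s _.
by have [y yE] := ses_surj s' z; exists (q y); rewrite (compE fE).
Qed.

Lemma ses_isol M M' N Q (i : 'Hom(M, N)) (q : 'Hom(N, Q)) (f : 'Hom(M', M)) :
  f \in homA M' M -> bijective f -> ses i q -> ses (i \o f)%VF q.
Proof.
move=> hf /bij_injsurj[fi fs] [hi hq ii qs qi kq]; split=> //.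
- exact: hom_comp.
- by move=> x; rewrite comp_lfunE => /ii/fi.
- by move=> x; rewrite comp_lfunE.
- by move=> y /kq[x ->]; have [z <-] := fs x; exists z; rewrite comp_lfunE.
Qed.

Lemma ses_isor M N Q Q' (i : 'Hom(M, N)) (q : 'Hom(N, Q)) (f : 'Hom(Q, Q')) :
  f \in homA Q Q' -> bijective f -> ses i q -> ses i (f \o q)%VF.
Proof.
move=> hf /bij_injsurj[fi fs] [hi hq ii qs qi kq]; split=> //.
- exact: hom_comp.
- by move=> z; have [y <-] := fs z; have [x <-] := qs y; exists x; rewrite comp_lfunE.
- by move=> x; rewrite comp_lfunE qi linear0.
- by move=> y; rewrite comp_lfunE => /fi/kq.
Qed.

Lemma ex_lfun (V W : vectType K) (f : V -> W) :
  linear f -> exists g : 'Hom(V, W), forall x, g x = f x.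
Proof.
move=> lf; pose g : {linear V -> W} := HB.pack f (GRing.isLinear.Build K V W *:%R f lf).
by exists (linfun g) => x; rewrite lfunE.
Qed.

Lemma ex_hom M N (f : M -> N) :
  linear f -> (forall a v, f (act M a v) = act N a (f v)) ->
  exists2 g : 'Hom(M, N), g \in homA M N & forall x, g x = f x.
Proof.
move=> lf cf; have [g gE] := ex_lfun lf.
by exists g => //; apply: homP => a v; rewrite !gE.
Qed.

(* The remaining identities p j = 0 and q i = 0 follow, see [bi_pj] and [bi_qi]. *)
Record biprod M N X (i : 'Hom(M, X)) (j : 'Hom(N, X)) (p : 'Hom(X, M))
    (q : 'Hom(X, N)) : Prop := Biprod {
  bi_i : i \in homA M X;
  bi_j : j \in homA N X;
  bi_p : p \in homA X M;
  bi_q : q \in homA X N;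
  bi_pi : (p \o i)%VF = \1%VF;
  bi_qj : (q \o j)%VF = \1%VF;
  bi_sum : ((i \o p) + (j \o q))%VF = \1%VF }.

Lemma biprod_dsum M N : exists i j p q, @biprod M N (dsum M N) i j p q.
Proof.
have aE a (x : M * N) : act (dsum M N) a x = (act M a x.1, act N a x.2).
  exact: mk_amodE.
have [|a v|i hi iE] := @ex_hom M (dsum M N) (fun x => (x, 0)).
- by move=> k x y; congr pair; rewrite /= scaler0 addr0.
- by rewrite aE /= linear0.
have [|a v|j hj jE] := @ex_hom N (dsum M N) (fun x => (0, x)).
- by move=> k x y; congr pair; rewrite /= scaler0 addr0.
- by rewrite aE /= linear0.
have [|a v|p hp pE] := @ex_hom (dsum M N) M (fun x : M * N => x.1).
- by [].
- by rewrite aE.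
have [|a v|q hq qE] := @ex_hom (dsum M N) N (fun x : M * N => x.2).
- by [].
- by rewrite aE.
exists i, j, p, q; split=> //; apply/lfunP=> x.
- by rewrite comp_lfunE iE pE id_lfunE.
- by rewrite comp_lfunE jE qE id_lfunE.
rewrite add_lfunE !comp_lfunE id_lfunE iE jE pE qE.
by case: x => x y; congr pair; rewrite /= ?addr0 ?add0r.
Qed.

Section Biprod.
Variables (M N X : amod A) (i : 'Hom(M, X)) (j : 'Hom(N, X)).
Variables (p : 'Hom(X, M)) (q : 'Hom(X, N)).
Hypothesis b : biprod i j p q.

Lemma bi_sumE x : i (p x) + j (q x) = x.
Proof. by rewrite -!comp_lfunE -add_lfunE (bi_sum b) id_lfunE. Qed.

Lemma bi_piE x : p (i x) = x.
Proof. by rewrite (compE (bi_pi b)) id_lfunE. Qed.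

Lemma bi_qjE x : q (j x) = x.
Proof. by rewrite (compE (bi_qj b)) id_lfunE. Qed.

Lemma bi_qi x : q (i x) = 0.
Proof.
have /(congr1 q) := bi_sumE (i x); rewrite bi_piE linearD /= bi_qjE => /eqP.
by rewrite -subr_eq0 -addrA subrr addr0 => /eqP.
Qed.

Lemma bi_pj x : p (j x) = 0.
Proof.
have /(congr1 p) := bi_sumE (j x); rewrite bi_qjE linearD /= bi_piE => /eqP.
by rewrite -subr_eq0 -addrA subrr addr0 => /eqP.
Qed.

Lemma biprod_swap : biprod j i q p.
Proof. by case: b => *; split=> //; rewrite addrC. Qed.

Lemma ses_biprod : ses i q.
Proof.
have [hi hj hp hq _ _ _] := b; split=> //.
- by move=> x ix; rewrite -(bi_piE x) ix linear0.
- by move=> z; exists (j z); rewrite bi_qjE.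
- exact: bi_qi.
- by move=> y qy; exists (p y); rewrite -{1}(bi_sumE y) qy linear0 addr0.
Qed.
End Biprod.

Lemma biprod_iso M N X i j p q : @biprod M N X i j p q -> iso X (dsum M N).
Proof.
move=> b; have [i' [j' [p' [q' b']]]] := biprod_dsum M N.
have [hi hj hp hq _ _ _] := b; have [hi' hj' hp' hq' _ _ _] := b'.
apply/isoP; exists ((i' \o p) + (j' \o q))%VF, ((i \o p') + (j \o q'))%VF.
split; try by apply: memvD; apply: hom_comp.
all: apply/lfunP=> x; rewrite !(comp_lfunE, add_lfunE, id_lfunE) !linearD /=.
  by rewrite (bi_piE b') (bi_pj b') (bi_qi b') (bi_qjE b') !linear0 addr0 add0r (bi_sumE b).
by rewrite (bi_piE b) (bi_pj b) (bi_qi b) (bi_qjE b) !linear0 addr0 add0r (bi_sumE b').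
Qed.

Lemma iso_biprod M N X :
  iso X (dsum M N) -> exists i j p q, @biprod M N X i j p q.
Proof.
move=> /isoP[f [g [hf hg gf fg]]]; have [i [j [p [q b]]]] := biprod_dsum M N.
have [hi hj hp hq _ _ _] := b.
have fgE x : f (g x) = x by rewrite (compE fg) id_lfunE.
have gfE x : g (f x) = x by rewrite (compE gf) id_lfunE.
exists (g \o i)%VF, (g \o j)%VF, (p \o f)%VF, (q \o f)%VF.
split; try exact: hom_comp; apply/lfunP=> x.
- by rewrite !(comp_lfunE, id_lfunE) fgE (bi_piE b).
- by rewrite !(comp_lfunE, id_lfunE) fgE (bi_qjE b).
by rewrite !(comp_lfunE, id_lfunE, add_lfunE) -(linearD g) (bi_sumE b); apply: gfE.
Qed.

(** A direct summand given without a chosen complement; see [direct_summandP]. *)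
Definition retract N M : Prop := exists i p,
  [/\ i \in homA N M, p \in homA M N & (p \o i)%VF = \1%VF].

(** The complement is the kernel of [p], and [q] is [\1 - i \o p] with values regarded in that
    kernel. *)
Lemma retract_compl N M i p :
  i \in homA N M -> p \in homA M N -> (p \o i)%VF = \1%VF ->
  exists Q j q, @biprod N Q M i j p q.
Proof.
move=> hi hp pi; have piE x : p (i x) = x by rewrite (compE pi) id_lfunE.
have sp z : exists y, p y = z by exists (i z).
have s := ses_kernel hp sp; set k := sub_incl _ in s.
have hr : (\1 - (i \o p))%VF \in homA M M by apply/memvB/hom_comp=> //; apply: hom_id.
have [x|q hq qE] := factor_inj (ses_i s) hr (ses_inj s).
  apply: (ses_ker s); rewrite !(add_lfunE, opp_lfunE, comp_lfunE, id_lfunE).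
  by rewrite linearB /= piE subrr.
exists (sub_mod (ker_sub hp)), k, q; split=> //; first exact: ses_i s.
  apply/lfunP=> x; apply: (inj_eq0 (ses_inj s)); rewrite comp_lfunE (compE qE).
  rewrite !(add_lfunE, opp_lfunE, comp_lfunE, id_lfunE) (ses_comp s).
  by rewrite linear0 subr0.
by rewrite qE addrC subrK.
Qed.

Lemma direct_summandP N M : direct_summand N M <-> retract N M.
Proof.
split=> [[Q /iso_biprod[i [j [p [q b]]]]]|[i [p [hi hp pi]]]].
  by exists i, p; case: b.
by have [Q [j [q b]]] := retract_compl hi hp pi; exists Q; apply: biprod_iso b.
Qed.

Lemma retract_trans N M X : retract N M -> retract M X -> retract N X.
Proof.
move=> [i [p [hi hp pi]]] [j [q [hj hq qj]]]; exists (j \o i)%VF, (p \o q)%VF.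
split; try exact: hom_comp.
by rewrite -comp_lfunA (comp_lfunA q) qj comp_lfun1l.
Qed.

Lemma retract_refl M : retract M M.
Proof. by exists \1%VF, \1%VF; rewrite hom_id comp_lfun1l. Qed.

Lemma iso_retract M N : iso M N -> retract M N.
Proof. by move=> /isoP[f [g [*]]]; exists f, g. Qed.

Lemma biprod_retract M N X i j p q : @biprod M N X i j p q -> retract M X /\ retract N X.
Proof. by case=> *; split; [exists i, p|exists j, q]. Qed.

Lemma retract_dim N M : retract N M -> (\dim {:N} <= \dim {:M})%N.
Proof.
move=> [i [p [hi hp pi]]]; apply: (@inj_dim _ _ i) => x ix.
by rewrite -(id_lfunE x) -(compE pi) ix linear0.
Qed.

Lemma retract_iso N M : retract N M -> (\dim {:M} <= \dim {:N})%N -> iso N M.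
Proof.
move=> [i [p [hi hp pi]]] le.
have ii x : i x = 0 -> x = 0.
  by move=> ix; rewrite -(id_lfunE x) -(compE pi) ix linear0.
exact: bij_iso hi ii (inj_dim_surj ii le).
Qed.

Lemma retract_iso_indec N M :
  retract N M -> ~ zero_module N -> indecomposable M -> iso N M.
Proof.
move=> [i [p [hi hp pi]]] N0 [_ Mi].
have [Q [j [q b]]] := retract_compl hi hp pi.
case: (Mi _ _ (biprod_iso b)) => // Q0.
have := ses_dim (ses_biprod b); move/zero_dim: Q0 => ->; rewrite addn0 => E.
by apply: retract_iso; [exists i, p|rewrite E].
Qed.

Lemma zero_idP M : zero_module M <-> \1%VF = 0 :> 'End(M).
Proof.
rewrite zeroP; split=> [M0|E x]; last by rewrite -(id_lfunE x) E zero_lfunE.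
by apply/lfunP=> x; rewrite (M0 x) !linear0.
Qed.

Lemma zero_isoT M N : zero_module M -> zero_module N -> iso M N.
Proof.
move=> /zeroP M0 /zeroP N0; apply: (bij_iso (mem0v _)) => [x _|z]; first exact: M0.
by exists 0; rewrite (N0 z) linear0.
Qed.

Lemma biprod_iso2 M N X M' N' X' i j p q i' j' p' q' :
  @biprod M N X i j p q -> @biprod M' N' X' i' j' p' q' ->
  iso M M' -> iso N N' -> iso X X'.
Proof.
move=> b b' /isoP[f [f' [hf hf' f'f ff']]] /isoP[g [g' [hg hg' g'g gg']]].
have [hi hj hp hq _ _ _] := b; have [hi' hj' hp' hq' _ _ _] := b'.
apply/isoP; exists ((i' \o (f \o p)) + (j' \o (g \o q)))%VF.
exists ((i \o (f' \o p')) + (j \o (g' \o q')))%VF.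
split; try by apply: memvD; apply: hom_comp => //; apply: hom_comp.
all: apply/lfunP=> x; rewrite !(comp_lfunE, add_lfunE, id_lfunE) !linearD /=.
  rewrite (bi_piE b') (bi_pj b') (bi_qi b') (bi_qjE b') !linear0 addr0 add0r.
  by rewrite (compE f'f) (compE g'g) !id_lfunE (bi_sumE b).
rewrite (bi_piE b) (bi_pj b) (bi_qi b) (bi_qjE b) !linear0 addr0 add0r.
by rewrite (compE ff') (compE gg') !id_lfunE (bi_sumE b').
Qed.

Lemma decomposable M : ~ zero_module M -> ~ indecomposable M ->
  exists N Q i j p q, [/\ @biprod N Q M i j p q,
    (\dim {:N} < \dim {:M})%N & (\dim {:Q} < \dim {:M})%N].
Proof.
move=> M0 nMi; apply: NNPP => h; apply: nMi; split=> // N Q.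
case/iso_biprod=> i [j [p [q b]]]; apply: NNPP => nz; apply: h.
have E := ses_dim (ses_biprod b).
exists N, Q, i, j, p, q; split=> //; rewrite -E -subn_gt0.
  rewrite addKn lt0n; apply/negP=> /eqP/zero_dim Q0; apply: nz; by right.
rewrite addnK lt0n; apply/negP=> /eqP/zero_dim N0; apply: nz; by left.
Qed.

(* N is the image of f^(n+1) for n so large that f^(n+1) is bijective on it. *)
Lemma fitting X (f : 'End(X)) : f \in homA X X ->
  exists N (i : 'Hom(N, X)) (p : 'Hom(X, N)) n,
   [/\ i \in homA N X, p \in homA X N, (p \o i)%VF = \1%VF,
       forall x, p x = 0 <-> iter n.+1 f x = 0
     & forall x, exists y, iter n.+1 f x = i y].
Proof.
move=> hf.
(* [F n] is the power of [f] with exponent [n + 1]; as this is positive, the kernel of [f] lies in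
   that of [F n]. *)
pose F n : 'End(X) := iter n.+1 (fun g => f \o g)%VF \1%VF.
have FE n x : F n x = iter n.+1 f x.
  by rewrite /F; elim: n.+1 => [|m IH] /=; rewrite ?id_lfunE ?comp_lfunE ?IH.
have hF n : F n \in homA X X.
  by rewrite /F; elim: n.+1 => [|m IH] /=; [exact: hom_id|exact: hom_comp].
(* Choose [n] such that the image of [F n] has the least dimension among positive powers. *)
have [n nP] : exists n, forall m, (\dim (limg (F n)) <= \dim (limg (F m)))%N.
  have : exists k n, \dim (limg (F n)) = k by exists (\dim (limg (F 0%N))), 0%N.
  move=> [k]; elim/ltn_ind: k => k IH [n En].
  case: (classic (exists m, (\dim (limg (F m)) < k)%N)) => [[m ltm]|nm].
    by apply: IH ltm _; exists m.
  by exists n => m; rewrite En leqNgt; apply/negP=> ltm; apply: nm; exists m.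
pose U := img_sub (hF n); have s := ses_sub U; set i := sub_incl U in s.
have hi := ses_i s; have ii := ses_inj s.
have [x|r hr rE] := factor_inj hi (hF n) ii.
  by apply: sub_incl_mem; rewrite memv_img ?memvf.
have iU z : exists y, i z = F n y.
  by rewrite /i sub_inclE; have /memv_imgP[y _ ->] := subvsP z; exists y.
have hri : (r \o i)%VF \in homA (sub_mod U) (sub_mod U) by apply: hom_comp.
(* [F (n + n.+1)] is the square of [F n], so [F n] maps its own image onto itself. *)
have F2 : limg (F (n + n.+1)%N) = limg (F n).
  apply/eqP; rewrite eqEdim nP andbT; apply/subvP=> _ /memv_imgP[y _ ->].
  by rewrite FE -addSn iterD -!FE memv_img ?memvf.
have sri z : exists y, (r \o i)%VF y = z.
  have [y yE] := iU z.
  have : F n y \in limg (F (n + n.+1)%N) by rewrite F2 memv_img ?memvf.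
  case/memv_imgP=> w _ wE; exists (r w); apply: (inj_eq0 ii).
  by rewrite comp_lfunE !(compE rE) yE wE [RHS]FE -addSn iterD -!FE.
have iri := proj1 (lker_inj _) _.
have {}iri x : (r \o i)%VF x = 0 -> x = 0.
  apply: iri x; apply/eqP; rewrite -dimv_eq0 -(eqn_add2r (\dim (limg (r \o i)%VF))).
  have := limg_ker_dim (r \o i)%VF fullv; rewrite capfv => ->.
  by move/limg_surj: sri => ->.
have [g [hg gl gr]] := bij_hom hri iri sri.
exists (sub_mod U), i, (g \o r)%VF, n; split=> //; first exact: hom_comp.
- by rewrite -comp_lfunA.
- move=> x; rewrite -FE -(compE rE) comp_lfunE; split=> [gx|/ii->].
    have -> : r x = 0 by rewrite -(id_lfunE (r x)) -gr comp_lfunE gx linear0.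
    by rewrite linear0.
  by rewrite linear0.
- by move=> x; exists (r x); rewrite (compE rE) FE.
Qed.

Lemma iter_fix0 X (f : 'End(X)) n x : f x = 0 -> iter n.+1 f x = 0.
Proof. by move=> fx; rewrite iterSr fx; elim: n => //= n ->; rewrite linear0. Qed.

(** The second alternative says that [\1 - f] is injective. One of the two Fitting summands attached
    to [f] vanishes, so [f] is nilpotent or injective. *)
Lemma indec_local X (f : 'End(X)) : indecomposable X -> f \in homA X X ->
  (forall x, f x = 0 -> x = 0) \/ (forall x, f x = x -> x = 0).
Proof.
move=> [_ Xi] hf; have [N [i [p [n [hi hp pi kp ip]]]]] := fitting hf.
have [Q [j [q b]]] := retract_compl hi hp pi.
case: (Xi _ _ (biprod_iso b)) => /zeroP Z0; [right|left] => x fx.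
  have <- : iter n.+1 f x = x by elim: n.+1 => //= m ->.
  exact/kp/Z0.
have /kp px := iter_fix0 n fx.
by rewrite -(bi_sumE b x) px (Z0 (q x)) !linear0 addr0.
Qed.

End Homs.

(** * Vanishing of extensions *)

Section Ext.
Variables (K : fieldType) (A : falgType K).
Implicit Types M N P Q X Y Z : amod A.

(* Both properties express the vanishing of Ext^1(M, N). *)
Definition liftp M N : Prop :=
  forall X Y (i : 'Hom(N, X)) (q : 'Hom(X, Y)) (f : 'Hom(M, Y)),
    ses i q -> f \in homA M Y -> exists2 h, h \in homA M X & (q \o h)%VF = f.

Definition extp M N : Prop :=
  forall X Y (i : 'Hom(Y, X)) (q : 'Hom(X, M)) (f : 'Hom(Y, N)),
    ses i q -> f \in homA Y N -> exists2 h, h \in homA X N & (h \o i)%VF = f.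

(** Pull the sequence back along [f]: the fibre product [E] is an extension of [M] by [N], split by
    [k]. Then [p \o u - i \o k] vanishes on [N] and descends to the lift of [f]. *)
Lemma extp_liftp M N : extp M N -> liftp M N.
Proof.
move=> eMN X Y i q f s hf.
have [iX [jM [p [r b]]]] := biprod_dsum X M.
pose g := ((q \o p) - (f \o r))%VF.
have gE x : g x = q (p x) - f (r x) by rewrite !(add_lfunE, opp_lfunE, comp_lfunE).
have hg : g \in homA (dsum X M) Y.
  by apply: memvB; apply: hom_comp (bi_p b) (ses_q s) || apply: hom_comp (bi_q b) hf.
have sg z : exists y, g y = z.
  have [x <-] := ses_surj s z; exists (iX x).
  by rewrite gE (bi_piE b) (bi_qi b) linear0 subr0.
have := ses_kernel hg sg; set u := sub_incl _ => su; set E := sub_mod _ in u su.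
have hru : (r \o u)%VF \in homA E M := hom_comp (ses_i su) (bi_q b).
have hpu : (p \o u)%VF \in homA E X := hom_comp (ses_i su) (bi_p b).
have hXi : (iX \o i)%VF \in homA N (dsum X M) := hom_comp (ses_i s) (bi_i b).
have [x|n hn nE] := factor_inj (ses_i su) hXi (ses_inj su).
  apply: (ses_ker su); rewrite comp_lfunE gE (bi_piE b) (bi_qi b) linear0 subr0.
  exact: ses_comp s _.
have sru z : exists y, (r \o u)%VF y = z.
  have [x xE] := ses_surj s (f z).
  have [|y yE] := ses_ker su (y := iX x + jM z).
    rewrite gE !linearD /= (bi_piE b) (bi_qi b) (bi_pj b) (bi_qjE b) !linear0 addr0 add0r xE.
    by rewrite subrr.
  by exists y; rewrite comp_lfunE -yE linearD /= (bi_qi b) (bi_qjE b) add0r.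
have sn : ses n (r \o u)%VF.
  split=> // [x nx|x|y].
  - apply: (ses_inj s); rewrite -(bi_piE b (i x)).
    by have := compE nE x; rewrite nx linear0 comp_lfunE => <-; rewrite linear0.
  - by rewrite comp_lfunE (compE nE) comp_lfunE (bi_qi b).
  rewrite comp_lfunE => ry; have := ses_comp su y; rewrite gE ry linear0 subr0.
  case/(ses_ker s) => x xE; exists x; apply: (inj_eq0 (ses_inj su)).
  by rewrite (compE nE) comp_lfunE -xE -[LHS](bi_sumE b) ry linear0 addr0.
have [k hk kE] := eMN _ _ _ _ _ sn (hom_id N).
have hd : ((p \o u) - (i \o k))%VF \in homA E X.
  by apply: memvB => //; apply: hom_comp hk (ses_i s).
have [x|h hh hE] := factor_surj hru hd sru.
  case/(ses_ker sn) => y ->; rewrite !(add_lfunE, opp_lfunE, comp_lfunE).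
  by rewrite (compE nE) (compE kE) comp_lfunE id_lfunE (bi_piE b) subrr.
exists h => //; apply/lfunP=> z; rewrite comp_lfunE; have [y <-] := sru z.
rewrite (compE hE) !(add_lfunE, opp_lfunE, comp_lfunE) linearB /= (ses_comp s) subr0.
by have := ses_comp su y; rewrite gE => /eqP; rewrite subr_eq0 => /eqP.
Qed.

(** [E] is the preimage of [M'] under [q]. *)
Lemma ses_preimage M' M M'' Y X (a : 'Hom(M', M)) (b : 'Hom(M, M''))
    (i : 'Hom(Y, X)) (q : 'Hom(X, M)) :
  ses a b -> ses i q ->
  exists (E : amod A) (u : 'Hom(E, X)) (i' : 'Hom(Y, E)) (q' : 'Hom(E, M')),
    [/\ ses u (b \o q)%VF, ses i' q' & (u \o i')%VF = i].
Proof.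
move=> sab s.
have hbq : (b \o q)%VF \in homA X M'' := hom_comp (ses_q s) (ses_q sab).
have sbq z : exists y, (b \o q)%VF y = z.
  have [y <-] := ses_surj sab z; have [x <-] := ses_surj s y.
  by exists x; rewrite comp_lfunE.
have := ses_kernel hbq sbq; set u := sub_incl _ => su; set E := sub_mod _ in u su.
have [x|i' hi' i'E] := factor_inj (ses_i su) (ses_i s) (ses_inj su).
  by apply: (ses_ker su); rewrite comp_lfunE (ses_comp s) linear0.
have hqu : (q \o u)%VF \in homA E M := hom_comp (ses_i su) (ses_q s).
have [x|q' hq' q'E] := factor_inj (ses_i sab) hqu (ses_inj sab).
  by apply: (ses_ker sab); have := ses_comp su x; rewrite !comp_lfunE.
exists E, u, i', q'; split=> //; split=> //.
- by move=> x ix; apply: (ses_inj s); rewrite -(compE i'E) ix linear0.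
- move=> z; have [x xE] := ses_surj s (a z).
  have [|y yE] := ses_ker su (y := x); first by rewrite comp_lfunE xE (ses_comp sab).
  by exists y; apply: (inj_eq0 (ses_inj sab)); rewrite (compE q'E) comp_lfunE -yE.
- move=> x; apply: (ses_inj sab); rewrite (compE q'E) comp_lfunE (compE i'E).
  exact: ses_comp s _.
- move=> y qy; have : q (u y) = 0 by have := compE q'E y; rewrite qy linear0 comp_lfunE.
  case/(ses_ker s) => x xE; exists x; apply: (inj_eq0 (ses_inj su)).
  by rewrite (compE i'E).
Qed.

(** Extend [f] first to the preimage of [M'] in [X], then to [X], whose quotient by this preimage is
    [M'']. *)
Lemma extp_ses1 M' M M'' N (a : 'Hom(M', M)) (b : 'Hom(M, M'')) :
  ses a b -> extp M' N -> extp M'' N -> extp M N.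
Proof.
move=> sab e1 e2 X Y i q f s hf.
have [E [u [i' [q' [su s' i'E]]]]] := ses_preimage sab s.
have [g hg gE] := e1 _ _ _ _ _ s' hf.
have [h hh hE] := e2 _ _ _ _ _ su hg.
by exists h => //; rewrite -i'E comp_lfunA hE.
Qed.

(** Lift first to [X / N'], an extension of [Y] by [N''], then along [X -> X / N'], whose kernel is
    [N']. *)
Lemma liftp_ses2 M N' N N'' (a : 'Hom(N', N)) (b : 'Hom(N, N'')) :
  ses a b -> liftp M N' -> liftp M N'' -> liftp M N.
Proof.
move=> sab e1 e2 X Y i q f s hf.
have hia : (i \o a)%VF \in homA N' X := hom_comp (ses_i sab) (ses_i s).
have iia x : (i \o a)%VF x = 0 -> x = 0.
  by rewrite comp_lfunE => /(ses_inj s)/(ses_inj sab).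
have := ses_coker hia iia; set c := quot_hom _ => sc; set E := quot_mod _ in c sc.
have [x|q' hq' q'E] := factor_surj (ses_q sc) (ses_q s) (ses_surj sc).
  by case/(ses_ker sc) => y ->; rewrite comp_lfunE (ses_comp s).
have hci : (c \o i)%VF \in homA N E := hom_comp (ses_i s) (ses_q sc).
have [x|n hn nE] := factor_surj (ses_q sab) hci (ses_surj sab).
  by case/(ses_ker sab) => y ->; have := ses_comp sc y; rewrite !comp_lfunE.
have s' : ses n q'.
  split=> //.
  - move=> y; have [x <-] := ses_surj sab y; rewrite (compE nE) comp_lfunE.
    case/(ses_ker sc) => z; rewrite comp_lfunE => /(inj_eq0 (ses_inj s)) ->.
    by rewrite (ses_comp sab).
  - move=> z; have [y <-] := ses_surj s z; exists (c y); exact: compE q'E _.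
  - move=> y; have [x <-] := ses_surj sab y.
    by rewrite (compE nE) comp_lfunE (compE q'E) (ses_comp s).
  - move=> y; have [x <-] := ses_surj sc y; rewrite (compE q'E).
    by case/(ses_ker s) => z ->; exists (b z); rewrite (compE nE) comp_lfunE.
have [g hg gE] := e2 _ _ _ _ _ s' hf.
have [h hh hE] := e1 _ _ _ _ _ sc hg.
by exists h => //; rewrite -q'E -comp_lfunA hE.
Qed.

Lemma liftp_retract1 M M' N : retract M' M -> liftp M N -> liftp M' N.
Proof.
move=> [j [p [hj hp pj]]] e X Y i q f s hf.
have [h hh hE] := e _ _ _ _ _ s (hom_comp hp hf).
exists (h \o j)%VF; first exact: hom_comp.
by rewrite comp_lfunA hE -comp_lfunA pj comp_lfun1r.
Qed.

Lemma extp_retract2 M N N' : retract N' N -> extp M N -> extp M N'.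
Proof.
move=> [j [p [hj hp pj]]] e X Y i q f s hf.
have [h hh hE] := e _ _ _ _ _ s (hom_comp hf hj).
exists (p \o h)%VF; first exact: hom_comp.
by rewrite -comp_lfunA hE comp_lfunA pj comp_lfun1l.
Qed.

Lemma extp_iso1 M M' N : iso M M' -> extp M N -> extp M' N.
Proof.
move=> /iso_sym[g hg bg] e X Y i q f s hf.
exact: e (ses_isor hg bg s) hf.
Qed.

Lemma projective_liftp P N : projective P -> liftp P N.
Proof.
move=> pP X Y i q f s hf.
by have [h hh hE] := pP _ _ _ _ (ses_q s) (proj2 (limg_surj q) (ses_surj s)) hf; exists h.
Qed.

Lemma zero_extp M N : zero_module M -> extp M N.
Proof.
move=> /zeroP M0 X Y i q f s hf.
have [x|h hh hE] := factor_inj (ses_i s) (hom_id X) (ses_inj s).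
  by rewrite id_lfunE; apply: (ses_ker s); apply: M0.
exists (f \o h)%VF; first exact: hom_comp.
apply/lfunP=> x; rewrite !comp_lfunE; congr (f _); apply: (inj_eq0 (ses_inj s)).
by rewrite (compE hE) id_lfunE.
Qed.

Lemma zero_liftp M N : zero_module N -> liftp M N.
Proof.
move=> /zeroP N0 X Y i q f s hf.
have [x|h hh hE] := factor_surj (ses_q s) (hom_id X) (ses_surj s).
  by case/(ses_ker s) => y ->; rewrite (N0 y) !linear0.
exists (h \o f)%VF; first exact: hom_comp.
apply/lfunP=> x; rewrite !comp_lfunE; have [y <-] := ses_surj s (f x).
by rewrite (compE hE) id_lfunE.
Qed.

(** As [P] is projective, the long exact sequence makes Ext^1(M, N) the cokernel of Hom(P, N) ->
    Hom(Q, N), and the hypothesis says that this map is onto. *)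
Lemma liftp_crit Q P M N (k : 'Hom(Q, P)) (pi : 'Hom(P, M)) :
  ses k pi -> projective P ->
  (forall phi, phi \in homA Q N -> exists2 psi, psi \in homA P N & (psi \o k)%VF = phi) ->
  liftp M N.
Proof.
move=> sk pP ex X Y i q f s hf.
have [g hg gE] := projective_liftp pP s (hom_comp (ses_q sk) hf).
have hgk : (g \o k)%VF \in homA Q X := hom_comp (ses_i sk) hg.
have [x|phi hphi phiE] := factor_inj (ses_i s) hgk (ses_inj s).
  apply: (ses_ker s); rewrite comp_lfunE (compE gE) comp_lfunE (ses_comp sk).
  by rewrite linear0.
have [psi hpsi psiE] := ex _ hphi.
have hd : (g - (i \o psi))%VF \in homA P X.
  by apply: memvB => //; apply: hom_comp hpsi (ses_i s).
have [x|h hh hE] := factor_surj (ses_q sk) hd (ses_surj sk).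
  case/(ses_ker sk) => y ->; rewrite !(add_lfunE, opp_lfunE, comp_lfunE).
  by rewrite (compE psiE) (compE phiE) comp_lfunE subrr.
exists h => //; apply/lfunP=> z; have [y <-] := ses_surj sk z.
rewrite comp_lfunE (compE hE) !(add_lfunE, opp_lfunE, comp_lfunE) linearB /=.
by rewrite (compE gE) (ses_comp s) subr0 comp_lfunE.
Qed.

(** [E] is the quotient of the direct sum of [M] and [P] by the image of [phi] minus [k]: the
    extension of [N] by [M] that [phi] determines. *)
Lemma pushout Q P N M (k : 'Hom(Q, P)) (pi : 'Hom(P, N)) (phi : 'Hom(Q, M)) :
  ses k pi -> phi \in homA Q M ->
  exists (E : amod A) (a : 'Hom(M, E)) (b : 'Hom(E, N)) (psi : 'Hom(P, E)),
    [/\ ses a b, psi \in homA P E & (psi \o k)%VF = (a \o phi)%VF].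
Proof.
move=> sk hphi; have [iM [jP [p [r b]]]] := biprod_dsum M P.
pose c := ((iM \o phi) - (jP \o k))%VF.
have cE x : c x = iM (phi x) - jP (k x) by rewrite !(add_lfunE, opp_lfunE, comp_lfunE).
have hc : c \in homA Q (dsum M P).
  by apply: memvB; [apply: hom_comp hphi (bi_i b)|apply: hom_comp (ses_i sk) (bi_j b)].
have rc x : r (c x) = - k x by rewrite cE linearB /= (bi_qi b) (bi_qjE b) sub0r.
have ic x : c x = 0 -> x = 0.
  by move=> cx; apply: (ses_inj sk); apply/eqP; rewrite -oppr_eq0 -rc cx linear0.
have := ses_coker hc ic; set w := quot_hom _ => sw; set E := quot_mod _ in w sw.
have [x|d hd dE] := factor_surj (ses_q sw) (hom_comp (bi_q b) (ses_q sk)) (ses_surj sw).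
  by case/(ses_ker sw) => y ->; rewrite comp_lfunE rc linearN /= (ses_comp sk) oppr0.
have wc x : w (jP (k x)) = w (iM (phi x)).
  have := ses_comp sw x; rewrite cE linearB /= => /eqP.
  by rewrite subr_eq0 eq_sym => /eqP.
exists E, (w \o iM)%VF, d, (w \o jP)%VF; split.
- split=> //; first exact: hom_comp (bi_i b) (ses_q sw).
  + move=> x; rewrite comp_lfunE => /(ses_ker sw)[y yE].
    have ky : k y = 0 by apply/eqP; rewrite -oppr_eq0 -rc -yE (bi_qi b).
    by rewrite -(bi_piE b x) yE (ses_inj sk ky) !linear0.
  + move=> z; have [y <-] := ses_surj sk z; exists (w (jP y)).
    by rewrite (compE dE) comp_lfunE (bi_qjE b).
  + by move=> x; rewrite comp_lfunE (compE dE) comp_lfunE (bi_qi b) linear0.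
  + move=> y; have [x <-] := ses_surj sw y.
    rewrite (compE dE) comp_lfunE => /(ses_ker sk)[z zE].
    exists (p x + phi z); rewrite comp_lfunE !linearD /= -wc -zE -linearD /=.
    by rewrite (bi_sumE b).
- exact: hom_comp (bi_j b) (ses_q sw).
- by apply/lfunP=> x; rewrite !comp_lfunE wc.
Qed.

End Ext.

Lemma mod0_zero (K : fieldType) (A : falgType K) : zero_module (mod0 A).
Proof. by apply/zeroP=> x; apply: thinmx0. Qed.

Lemma ses_mod0 (K : fieldType) (A : falgType K) (M : amod A) :
  ses (\1%VF : 'End(M)) (0 : 'Hom(M, mod0 A)).
Proof.
split=> [||x|z|x|y _]; rewrite ?hom_id ?mem0v ?id_lfunE ?zero_lfunE //.
  exists 0; rewrite linear0; apply: esym.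
  by move: z; apply/zeroP/mod0_zero.
by exists y; rewrite id_lfunE.
Qed.

(** [E] is the direct sum of [U] and [P], mapped to [M] by [u] and [t], as in Schanuel's lemma.
    Vanishing of Ext^1 for [Q] and [M] thereby passes to [U]. *)
Lemma ses_syzygy (K : fieldType) (A : falgType K) (Q P X U M : amod A)
    (k : 'Hom(Q, P)) (pi : 'Hom(P, X)) (u : 'Hom(U, M)) (g : 'Hom(M, X)) (t : 'Hom(P, M)) :
  ses k pi -> ses u g -> t \in homA P M -> (g \o t)%VF = pi ->
  exists (E : amod A) (a : 'Hom(Q, E)) (c : 'Hom(E, M)), ses a c /\ retract U E.
Proof.
move=> sD sg ht tE.
have [x|v hv vE] := factor_inj (ses_i sg) (hom_comp (ses_i sD) ht) (ses_inj sg).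
  by apply: (ses_ker sg); rewrite comp_lfunE (compE tE) (ses_comp sD).
have [iU [jP [pU [qP b]]]] := biprod_dsum U P.
pose a := ((jP \o k) - (iU \o v))%VF.
pose c := ((u \o pU) + (t \o qP))%VF.
have aE x : a x = jP (k x) - iU (v x) by rewrite !(add_lfunE, opp_lfunE, comp_lfunE).
have cE x : c x = u (pU x) + t (qP x) by rewrite !(add_lfunE, comp_lfunE).
have sac : ses a c.
  split.
  - by apply: memvB; [apply: hom_comp (ses_i sD) (bi_j b)|apply: hom_comp hv (bi_i b)].
  - by apply: memvD; [apply: hom_comp (bi_p b) (ses_i sg)|apply: hom_comp (bi_q b) ht].
  - move=> x ax; apply: (ses_inj sD); rewrite -(bi_qjE b (k x)).
    have -> : jP (k x) = iU (v x) by apply/eqP; rewrite -subr_eq0 -aE ax.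
    exact: bi_qi b _.
  - move=> z; have [y yE] := ses_surj sD (g z).
    have [|x xE] := ses_ker sg (y := z - t y).
      by rewrite linearB /= (compE tE) yE subrr.
    exists (iU x + jP y); rewrite cE !linearD /= (bi_piE b) (bi_pj b) (bi_qi b) (bi_qjE b).
    by rewrite !linear0 addr0 add0r -xE subrK.
  - move=> x; rewrite aE cE !linearB /= (bi_piE b) (bi_pj b) (bi_qi b) (bi_qjE b).
    by rewrite !linear0 sub0r addr0 (compE vE) comp_lfunE addrC subrr.
  - move=> y cy; have : pi (qP y) = 0.
      have := congr1 g cy; rewrite cE linearD /= (ses_comp sg) add0r (compE tE).
      by rewrite linear0.
    case/(ses_ker sD) => x xE; exists x.
    have ux : u (pU y + v x) = 0.
      by rewrite linearD /= (compE vE) comp_lfunE -xE -cE cy.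
    rewrite aE -xE -[LHS](bi_sumE b) addrC; congr (_ + _); rewrite -linearN; congr (iU _).
    by apply/eqP; rewrite -addr_eq0; apply/eqP; apply: (ses_inj sg).
exists (dsum U P), a, c; split=> //.
by case: (biprod_retract b).
Qed.

(** * Filtrations *)

Section Filtration.
Variables (K : fieldType) (A : falgType K) (Lam : Type) (X : Lam -> amod A).
Implicit Types M N Q U : amod A.

Lemma filt_nil M : filtration X M [::] <-> zero_module M.
Proof. by split=> [fM|]; [inversion fM | exact: Filt0]. Qed.

Lemma filt_consE M mu s : filtration X M (mu :: s) ->
  exists (U : amod A) (i : 'Hom(U, M)) (q : 'Hom(M, X mu)), ses i q /\ filtration X U s.
Proof.
move=> fM; inversion fM as [|M' U mu' s' fU [f hf bf]]; subst.
exists (sub_mod U), (sub_incl U), (f \o quot_hom U)%VF; split=> //.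
exact: ses_isor hf bf (ses_sub U).
Qed.

Lemma filt_iso M N s : iso M N -> filtration X M s -> filtration X N s.
Proof.
elim: s M N => [|mu s IH] M N iMN; first by rewrite !filt_nil; apply: zero_iso.
case/filt_consE=> U [i [q [sq fU]]].
have [f [g [hf hg gf fg]]] := proj1 (isoP M N) iMN.
have hq : (q \o g)%VF \in homA N (X mu) := hom_comp hg (ses_q sq).
have s' : ses (f \o i)%VF (q \o g)%VF.
  split=> //; first exact: hom_comp (ses_i sq) hf.
  - move=> x; rewrite comp_lfunE => /(congr1 g); rewrite (compE gf) id_lfunE linear0.
    exact: ses_inj sq _.
  - move=> z; have [y <-] := ses_surj sq z; exists (f y).
    by rewrite comp_lfunE (compE gf) id_lfunE.
  - by move=> x; rewrite !comp_lfunE (compE gf) id_lfunE (ses_comp sq).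
  - move=> y; rewrite comp_lfunE => /(ses_ker sq)[x xE]; exists x.
    by rewrite comp_lfunE -xE (compE fg) id_lfunE.
have sk := ses_kernel hq (ses_surj s').
apply: (FiltS (U := ker_sub hq)); last exact: ses_iso_quot (ses_sub _) sk.
by apply: IH fU; apply: ses_iso_sub s' sk.
Qed.

Lemma filt_cons U M mu s (i : 'Hom(U, M)) (q : 'Hom(M, X mu)) :
  ses i q -> filtration X U s -> filtration X M (mu :: s).
Proof.
move=> sq fU; have sk := ses_kernel (ses_q sq) (ses_surj sq).
apply: (FiltS (U := ker_sub (ses_q sq))); last exact: ses_iso_quot (ses_sub _) sk.
by apply: filt_iso fU; apply: ses_iso_sub sq sk.
Qed.

Lemma ses_zero_iso N M Q (i : 'Hom(N, M)) (q : 'Hom(M, Q)) :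
  ses i q -> zero_module Q -> iso N M.
Proof.
move=> s /zeroP Q0; apply: (bij_iso (ses_i s) (ses_inj s)) => z.
by have [x ->] := ses_ker s (Q0 (q z)); exists x.
Qed.

(** Induction on the filtration of [Q]: its first submodule is replaced by the preimage in [M]. *)
Lemma filt_cat N M Q s t (i : 'Hom(N, M)) (q : 'Hom(M, Q)) :
  ses i q -> filtration X Q s -> filtration X N t -> filtration X M (s ++ t).
Proof.
elim: s M Q i q => [|mu s IH] M Q i q sq.
  by move/filt_nil=> Q0; apply: filt_iso; apply: ses_zero_iso sq Q0.
case/filt_consE=> U [j [r [sr fU]]] fN.
have [E [u [i' [q' [su s' _]]]]] := ses_preimage sr sq.
exact: filt_cons su (IH E U i' q' s' fU fN).
Qed.

Lemma filt_one mu M : iso M (X mu) -> filtration X M [:: mu].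
Proof.
move=> [f hf /bij_injsurj[fi fs]].
have s := ses_kernel hf fs; apply: (filt_cons s); apply/filt_nil/zeroP=> x.
by apply: (ses_inj s); apply: fi; apply: (ses_comp s).
Qed.

End Filtration.

(** * Dualities *)

Section Duality.
Variables (K : fieldType) (A : falgType K) (D : cofunctor A).
Variable eta : forall M : amod A, 'Hom(M, D (D M)).
Implicit Types M N P Q X Y Z T : amod A.
Hypothesis Dex : exact_cofunctor D.
Hypothesis eta_iso : forall M, eta M \in homA M (D (D M)) /\ bijective (eta M).
Hypothesis eta_nat : forall M N (f : 'Hom(M, N)), f \in homA M N ->
  (cof_map D (cof_map D f) \o eta M = eta N \o f)%VF.

Lemma D_ses M N Q (i : 'Hom(M, N)) (q : 'Hom(N, Q)) :
  ses i q -> ses (cof_map D q) (cof_map D i).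
Proof.
case/sesP=> [hi hq s]; apply/sesP; split; try exact: cof_hom.
exact: Dex.2 hi hq s.
Qed.

Lemma D_0 M N : cof_map D (0 : 'Hom(M, N)) = 0.
Proof.
have := Dex.1 _ _ _ _ (mem0v (homA M N)) (mem0v _); rewrite addr0 => /eqP.
by rewrite -subr_eq0 opprD addrA subrr add0r oppr_eq0 => /eqP.
Qed.

Lemma eta_hom M : eta M \in homA M (D (D M)).
Proof. by have [] := eta_iso M. Qed.

Lemma eta_inj M x : eta M x = 0 -> x = 0.
Proof. by have [_ /bij_injsurj[ei _]] := eta_iso M; apply: ei. Qed.

Lemma eta_surj M z : exists y, eta M y = z.
Proof. by have [_ /bij_injsurj[_ es]] := eta_iso M. Qed.

Lemma eta_natE M N (f : 'Hom(M, N)) x : f \in homA M N ->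
  cof_map D (cof_map D f) (eta M x) = eta N (f x).
Proof. by move=> /eta_nat/compE ->; rewrite comp_lfunE. Qed.

Lemma D_faithful M N (f : 'Hom(M, N)) : f \in homA M N -> cof_map D f = 0 -> f = 0.
Proof.
move=> hf f0; apply/lfunP=> x; rewrite zero_lfunE; apply: eta_inj.
by rewrite -eta_natE // f0 D_0 zero_lfunE.
Qed.

Lemma DD_iso M : iso M (D (D M)).
Proof. by exists (eta M); case: (eta_iso M). Qed.

Lemma D_zero M : zero_module M -> zero_module (D M).
Proof. by rewrite !zero_idP => E; rewrite -cof_id E D_0. Qed.

Lemma D_biprod M N X i j p q : @biprod K A M N X i j p q ->
  biprod (cof_map D p) (cof_map D q) (cof_map D i) (cof_map D j).
Proof.
case=> hi hj hp hq pi qj E; split; try exact: cof_hom.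
- by rewrite -cof_comp // pi cof_id.
- by rewrite -cof_comp // qj cof_id.
- by rewrite -!cof_comp // -(Dex.1) ?E ?cof_id //; apply: hom_comp.
Qed.

Lemma D_indec M : indecomposable M -> indecomposable (D M).
Proof.
move=> [M0 Mi]; split=> [/D_zero|N Q /iso_biprod[i [j [p [q b]]]]].
  by move/(zero_iso (iso_sym (DD_iso M))).
have b' := biprod_iso (D_biprod b).
by have [] := Mi _ _ (iso_trans (DD_iso M) b') => /D_zero H; [left|right];
  apply: zero_iso (iso_sym (DD_iso _)) H.
Qed.

Lemma D_surjinj M N (f : 'Hom(M, N)) : f \in homA M N ->
  (forall z, exists y, f y = z) -> forall x, cof_map D f x = 0 -> x = 0.
Proof. by move=> hf fs; apply: ses_inj (D_ses (ses_kernel hf fs)). Qed.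

(** Dualising an extension of [D N] by [Y] gives, via [eta], an extension of [D Y] by [N]. The map
    [M -> D Y] obtained from [f] lifts along it, and the dual of the lift extends [f] up to an
    automorphism. *)
Lemma liftp_D M N : liftp M N -> extp (D N) (D M).
Proof.
move=> e X Y i q f s hf.
have s' : ses (cof_map D q \o eta N)%VF (cof_map D i).
  by have [h1 h2] := eta_iso N; apply: ses_isol h1 h2 (D_ses s).
have hg : (cof_map D f \o eta M)%VF \in homA M (D Y).
  by apply: hom_comp (eta_hom M) _; apply: cof_hom.
have [k hk kE] := e _ _ _ _ _ s' hg.
(* c is an automorphism of D M; no triangle identity is available to say that it is 1. *)
pose c := (cof_map D (eta M) \o eta (D M))%VF.
have hc : c \in homA (D M) (D M).
  by apply: hom_comp (eta_hom _) _; apply: cof_hom; apply: eta_hom.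
have ci x : c x = 0 -> x = 0.
  rewrite comp_lfunE => cx; apply: eta_inj; apply: D_surjinj cx; first exact: eta_hom.
  exact: eta_surj.
have cs := inj_dim_surj ci (leqnn _).
have [g [hg' gc _]] := bij_hom hc ci cs.
exists (g \o (cof_map D k \o eta X))%VF.
  by apply: hom_comp _ hg'; apply: hom_comp (eta_hom X) (cof_hom D hk).
apply/lfunP=> y; rewrite !comp_lfunE -eta_natE ?(ses_i s) //.
rewrite -(@comp_lfunE _ _ _ _ (cof_map D k)) -cof_comp ?kE //; last first.
  by apply: cof_hom; apply: ses_i s.
rewrite cof_comp ?eta_hom // ?cof_hom // comp_lfunE eta_natE //.
by rewrite -(@comp_lfunE _ _ _ _ (cof_map D (eta M))) (compE gc) id_lfunE.
Qed.

(** The converse of [extp_liftp], by dualising twice: [liftp_D] turns lifting into extension, and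
    [extp_liftp] turns this back into lifting for the duals. *)
Lemma liftp_extp M N : liftp M N -> extp M N.
Proof.
move=> /liftp_D/extp_liftp/liftp_D e.
apply: extp_iso1 (iso_sym (DD_iso M)) _.
exact: extp_retract2 (iso_retract (DD_iso N)) e.
Qed.

Lemma liftp_DD M N : liftp M N -> liftp (D N) (D M).
Proof. by move/liftp_D/extp_liftp. Qed.

(** The list is reversed because [D] exchanges submodules and quotients. *)
Lemma filt_D (Lam : Type) (X X' : Lam -> amod A) M s :
  (forall lam, iso (D (X lam)) (X' lam)) ->
  filtration X M s -> filtration X' (D M) (rev s).
Proof.
move=> XX'; elim: s M => [|mu s IH] M.
  by rewrite !filt_nil; apply: D_zero.
move=> fM; have [U [i [q [/D_ses sq /IH fU]]]] := filt_consE fM; rewrite rev_cons -cats1.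
exact: filt_cat sq fU (filt_one (XX' mu)).
Qed.

End Duality.

(** * Generation and cogeneration *)

Section Generation.
Variables (K : fieldType) (A : falgType K).
Implicit Types M N P Q X Y Z T : amod A.

(** Equivalently, [X] is the sum of the images of [T]. Phrased by the vanishing of maps, the notion
    is exchanged with [cog] by a duality. *)
Definition gen X T : Prop := forall Z (f : 'Hom(X, Z)), f \in homA X Z ->
  (forall phi, phi \in homA T X -> (f \o phi)%VF = 0) -> f = 0.

Definition cog X T : Prop := forall Z (f : 'Hom(Z, X)), f \in homA Z X ->
  (forall phi, phi \in homA X T -> (phi \o f)%VF = 0) -> f = 0.

Lemma gen_iso X X' T T' : iso X X' -> iso T T' -> gen X T -> gen X' T'.
Proof.
move=> /isoP[u [v [hu hv vu uv]]] /isoP[t [t' [ht ht' tt tt']]] g Z f hf f0.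
have -> : f = ((f \o u) \o v)%VF by rewrite -comp_lfunA uv comp_lfun1r.
suff -> : (f \o u)%VF = 0 by apply/lfunP=> x; rewrite comp_lfunE !zero_lfunE.
apply: g => [|phi hphi]; first exact: hom_comp.
have := f0 ((u \o phi) \o t')%VF (hom_comp ht' (hom_comp hphi hu)) => E.
rewrite -[phi]comp_lfun1r -tt; apply/lfunP=> x; have := compE E (t x).
by rewrite !comp_lfunE !zero_lfunE.
Qed.

Lemma cog_iso X X' T T' : iso X X' -> iso T T' -> cog X T -> cog X' T'.
Proof.
move=> /isoP[u [v [hu hv vu uv]]] /isoP[t [t' [ht ht' tt tt']]] g Z f hf f0.
have -> : f = (u \o (v \o f))%VF by rewrite comp_lfunA uv comp_lfun1l.
suff -> : (v \o f)%VF = 0 by apply/lfunP=> x; rewrite comp_lfunE !zero_lfunE linear0.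
apply: g => [|phi hphi]; first exact: hom_comp.
have := f0 (t \o (phi \o v))%VF (hom_comp (hom_comp hv hphi) ht) => E.
apply/lfunP=> x; have := congr1 t' (compE E x).
by rewrite !comp_lfunE (compE tt) !zero_lfunE linear0 id_lfunE.
Qed.

Section GenDual.
Variables (D : cofunctor A) (eta : forall M : amod A, 'Hom(M, D (D M))).
Hypothesis Dex : exact_cofunctor D.
Hypothesis eta_iso : forall M, eta M \in homA M (D (D M)) /\ bijective (eta M).
Hypothesis eta_nat : forall M N (f : 'Hom(M, N)), f \in homA M N ->
  (cof_map D (cof_map D f) \o eta M = eta N \o f)%VF.

Lemma cog_D X T : cog X T -> gen (D X) (D T).
Proof.
move=> cX Z f hf f0; apply: (D_faithful Dex eta_iso eta_nat hf).
have [g [hg _ eg]] := bij_hom (eta_hom eta_iso X) (eta_inj eta_iso (M := X))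
  (eta_surj eta_iso (M := X)).
have hDf := cof_hom D hf.
have g0 : (g \o cof_map D f)%VF = 0.
  apply: cX => [|psi hpsi]; first exact: hom_comp.
  apply/lfunP=> z; rewrite zero_lfunE; apply: (eta_inj eta_iso).
  rewrite 2!comp_lfunE -(eta_natE eta_nat) // (compE eg) id_lfunE.
  rewrite -(@comp_lfunE _ _ _ _ (cof_map D (cof_map D psi))) -cof_comp ?cof_hom //.
  by rewrite f0 ?cof_hom // D_0 // zero_lfunE.
by apply/lfunP=> z; rewrite zero_lfunE -(id_lfunE (cof_map D f z)) -eg comp_lfunE
  (compE g0) zero_lfunE linear0.
Qed.

Lemma gen_D X T : gen X T -> cog (D X) (D T).
Proof.
move=> cX Z f hf f0; apply: (D_faithful Dex eta_iso eta_nat hf).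
have hDf := cof_hom D hf.
have g0 : (cof_map D f \o eta X)%VF = 0.
  apply: cX => [|psi hpsi]; first exact: hom_comp (eta_hom eta_iso X) _.
  apply/lfunP=> z; rewrite zero_lfunE 2!comp_lfunE -(eta_natE eta_nat) //.
  rewrite -(@comp_lfunE _ _ _ _ (cof_map D f)) -cof_comp ?cof_hom //.
  by rewrite f0 ?cof_hom // D_0 // zero_lfunE.
apply/lfunP=> z; have [y <-] := eta_surj eta_iso z.
by rewrite (compE g0) !zero_lfunE.
Qed.
End GenDual.
End Generation.

(** * Vanishing of homomorphisms *)

Section Hom0.
Variables (K : fieldType) (A : falgType K).
Implicit Types M N P Q X Y Z S E : amod A.

(** With [M] the projective cover [P mu], this says that [L mu] is not a composition factor of [N];
    see [compfactorP]. *)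
Definition hom0 M N : Prop := forall f, f \in homA M N -> f = 0.

Lemma hom0_sub M N N' (i : 'Hom(N', N)) :
  i \in homA N' N -> (forall x, i x = 0 -> x = 0) -> hom0 M N -> hom0 M N'.
Proof.
move=> hi ii h f hf; apply/lfunP=> x; rewrite zero_lfunE; apply: ii.
by rewrite -comp_lfunE (h _ (hom_comp hf hi)) zero_lfunE.
Qed.

Lemma hom0_iso M N N' : iso N N' -> hom0 M N -> hom0 M N'.
Proof. by move/iso_sym=> [f hf /bij_injsurj[fi _]]; apply: hom0_sub hf fi. Qed.

Lemma hom0_ses M N' N N'' (i : 'Hom(N', N)) (q : 'Hom(N, N'')) :
  ses i q -> hom0 M N' -> hom0 M N'' -> hom0 M N.
Proof.
move=> s h1 h2 f hf.
have [x|g hg <-] := factor_inj (ses_i s) hf (ses_inj s).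
  by apply: (ses_ker s); rewrite -comp_lfunE (h2 _ (hom_comp hf (ses_q s))) zero_lfunE.
by apply/lfunP=> x; rewrite (h1 _ hg) comp_lfunE !zero_lfunE linear0.
Qed.

Lemma hom0_quot M N' N N'' (i : 'Hom(N', N)) (q : 'Hom(N, N'')) :
  projective M -> ses i q -> hom0 M N -> hom0 M N''.
Proof.
move=> pM s h f hf; have [g hg <-] := projective_liftp pM s hf.
by apply/lfunP=> x; rewrite (h _ hg) comp_lfunE !zero_lfunE linear0.
Qed.

Lemma nz_lfun M N (f : 'Hom(M, N)) : f <> 0 -> exists x, f x <> 0.
Proof.
move=> f0; apply: NNPP => h; apply: f0; apply/lfunP=> x; rewrite zero_lfunE.
by apply: NNPP => fx; apply: h; exists x.
Qed.

Lemma simple_surj M S (f : 'Hom(M, S)) : simple S -> f \in homA M S -> f <> 0 ->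
  forall z, exists y, f y = z.
Proof.
move=> [_ Ss] hf /nz_lfun[x fx]; apply/limg_surj.
case: (Ss (img_sub hf)) => //= E; case: fx; apply/eqP.
by rewrite -memv0 -E memv_img ?memvf.
Qed.

Lemma simple_inj M S (f : 'Hom(S, M)) : simple S -> f \in homA S M -> f <> 0 ->
  forall x, f x = 0 -> x = 0.
Proof.
move=> [_ Ss] hf f0; apply/lker_inj.
case: (Ss (ker_sub hf)) => //= E; case: f0; apply/lfunP=> x.
by apply/eqP; rewrite zero_lfunE -memv_ker E memvf.
Qed.

Lemma filt_hom0 (Lam : eqType) (X : Lam -> amod A) Y M s :
  filtration X M s -> (forall mu, mu \in s -> hom0 Y (X mu)) -> hom0 Y M.
Proof.
elim: s M => [|mu s IH] M.
  by move=> /filt_nil/zeroP M0 _ f hf; apply/lfunP=> x; rewrite zero_lfunE (M0 (f x)).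
move=> fM h; have [U [i [q [sq fU]]]] := filt_consE fM.
apply: hom0_ses sq _ (h _ (mem_head _ _)); apply: IH fU _ => nu nus.
by apply: h; rewrite inE nus orbT.
Qed.

Lemma filt_hom0V (Lam : eqType) (X : Lam -> amod A) Y M s mu :
  projective Y -> filtration X M s -> hom0 Y M -> mu \in s -> hom0 Y (X mu).
Proof.
move=> pY; elim: s M => [|nu s IH] M // fM h.
have [U [i [q [sq fU]]]] := filt_consE fM.
rewrite inE => /orP[/eqP->|]; first exact: hom0_quot pY sq h.
by apply: IH fU _; apply: hom0_sub (ses_i sq) (ses_inj sq) h.
Qed.

(** In the long exact sequence, Hom(M, N'') = 0 makes Ext^1(M, N') -> Ext^1(M, N) injective. *)
Lemma extp_hom0 M N' N N'' (i : 'Hom(N', N)) (q : 'Hom(N, N'')) :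
  ses i q -> hom0 M N'' -> extp M N -> extp M N'.
Proof.
move=> s h0 e X Y j p f sj hf.
have [h hh hE] := e _ _ _ _ _ sj (hom_comp hf (ses_i s)).
have [x|g hg gE] := factor_surj (ses_q sj) (hom_comp hh (ses_q s)) (ses_surj sj).
  by case/(ses_ker sj) => y ->; rewrite comp_lfunE (compE hE) comp_lfunE (ses_comp s).
have [x|k hk kE] := factor_inj (ses_i s) hh (ses_inj s).
  by apply: (ses_ker s); rewrite -comp_lfunE -gE (h0 _ hg) comp_lfunE zero_lfunE.
exists k => //; apply/lfunP=> x; apply: (inj_eq0 (ses_inj s)).
by rewrite comp_lfunE (compE kE) (compE hE) comp_lfunE.
Qed.

Lemma filt_liftp (Lam : eqType) (X : Lam -> amod A) Y M s :
  filtration X M s -> (forall mu, mu \in s -> liftp Y (X mu)) -> liftp Y M.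
Proof.
elim: s M => [|mu s IH] M; first by move=> /filt_nil M0 _; apply: zero_liftp.
move=> fM h; have [U [i [q [sq fU]]]] := filt_consE fM.
apply: liftp_ses2 sq _ (h _ (mem_head _ _)); apply: IH fU _ => nu nus.
by apply: h; rewrite inE nus orbT.
Qed.

Lemma filt_extp (Lam : eqType) (X : Lam -> amod A) Y M s :
  filtration X M s -> (forall mu, mu \in s -> extp (X mu) Y) -> extp M Y.
Proof.
elim: s M => [|mu s IH] M; first by move=> /filt_nil M0 _; apply: zero_extp.
move=> fM h; have [U [i [q [sq fU]]]] := filt_consE fM.
apply: extp_ses1 sq _ (h _ (mem_head _ _)); apply: IH fU _ => nu nus.
by apply: h; rewrite inE nus orbT.
Qed.

Lemma filt_fam (Lam : Type) (X X' : Lam -> amod A) M s :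
  (forall lam, iso (X lam) (X' lam)) -> filtration X M s -> filtration X' M s.
Proof.
move=> XX'; elim: s M => [|mu s IH] M; first by rewrite !filt_nil.
move=> fM; have [U [i [q [sq fU]]]] := filt_consE fM.
have [f hf bf] := XX' mu.
exact: filt_cons (ses_isor hf bf sq) (IH _ fU).
Qed.

(** [C] is [E / M], with submodule [N / M] and quotient [E / N]. *)
Lemma ses_comp2 M N E Q Q' (a : 'Hom(M, N)) (b : 'Hom(N, Q)) (a' : 'Hom(N, E))
    (b' : 'Hom(E, Q')) : ses a b -> ses a' b' ->
  exists (C : amod A) (c : 'Hom(E, C)) (i : 'Hom(Q, C)) (q : 'Hom(C, Q')),
    ses (a' \o a)%VF c /\ ses i q.
Proof.
move=> s s'; have haa : (a' \o a)%VF \in homA M E := hom_comp (ses_i s) (ses_i s').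
have iaa x : (a' \o a)%VF x = 0 -> x = 0.
  by rewrite comp_lfunE => /(ses_inj s')/(ses_inj s).
have := ses_coker haa iaa; set c := quot_hom _ => sc; set C := quot_mod _ in c sc.
have [x|i hi iE] := factor_surj (ses_q s) (hom_comp (ses_i s') (ses_q sc)) (ses_surj s).
  by case/(ses_ker s) => y ->; have := ses_comp sc y; rewrite !comp_lfunE.
have [x|q hq qE] := factor_surj (ses_q sc) (ses_q s') (ses_surj sc).
  by case/(ses_ker sc) => y ->; rewrite comp_lfunE (ses_comp s').
exists C, c, i, q; split=> //; split=> //.
- move=> x; have [y <-] := ses_surj s x; rewrite (compE iE) comp_lfunE.
  case/(ses_ker sc)=> z; rewrite comp_lfunE => /(inj_eq0 (ses_inj s')) ->.
  exact: ses_comp s _.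
- by move=> z; have [y <-] := ses_surj s' z; exists (c y); rewrite (compE qE).
- move=> x; have [y <-] := ses_surj s x.
  by rewrite (compE iE) comp_lfunE (compE qE) (ses_comp s').
- move=> y; have [x <-] := ses_surj sc y; rewrite (compE qE).
  by case/(ses_ker s')=> z ->; exists (b z); rewrite (compE iE) comp_lfunE.
Qed.

End Hom0.

Lemma ex_minimal (d : Order.disp_t) (Lam : finPOrderType d) (Q : Lam -> Prop) x :
  Q x -> exists2 y, Q y & forall z, (z < y)%O -> ~ Q z.
Proof.
have [n] := ubnP #|[set y | (y < x)%O]|; elim: n x => // n IH x /ltnSE lexn Qx.
case: (classic (exists2 z, (z < x)%O & Q z)) => [[z zx Qz]|nz].
  apply: IH Qz; apply: leq_trans lexn; apply: proper_card; apply/properP; split.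
    by apply/subsetP=> w; rewrite !inE => /lt_trans; apply.
  by exists z; rewrite inE ?zx ?ltxx.
by exists x => // z zx Qz; apply: nz; exists z.
Qed.

Lemma ex_maximal (d : Order.disp_t) (Lam : finPOrderType d) (Q : Lam -> Prop) x :
  Q x -> exists2 y, Q y & forall z, (y < z)%O -> ~ Q z.
Proof.
have [n] := ubnP #|[set y | (x < y)%O]|; elim: n x => // n IH x /ltnSE lexn Qx.
case: (classic (exists2 z, (x < z)%O & Q z)) => [[z zx Qz]|nz].
  apply: IH Qz; apply: leq_trans lexn; apply: proper_card; apply/properP; split.
    by apply/subsetP=> w; rewrite !inE; apply: lt_trans.
  by exists z; rewrite inE ?zx ?ltxx.
by exists x => // z zx Qz; apply: nz; exists z.
Qed.

(** * Standard modules *)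

Section QH.
Variables (K : fieldType) (A : falgType K).
Variables (d : Order.disp_t) (Lam : finPOrderType d) (L P : Lam -> amod A).
Implicit Types M N Q X Y Z S U E : amod A.
Hypothesis Lsimple : complete_simples L.
Hypothesis Pcover : forall lam, projective_cover (P lam) (L lam).
Hypothesis qh : quasi_hereditary L P.

Local Notation Delta := (standard P).

Lemma Pproj lam : projective (P lam).
Proof. by case: (Pcover lam). Qed.

Lemma Lam_simple lam : simple (L lam).
Proof. by case: Lsimple. Qed.

Lemma top_ex M : ~ zero_module M -> exists lam (q : 'Hom(M, L lam)),
  q \in homA M (L lam) /\ forall z, exists y, q y = z.
Proof.
have [n] := ubnP (\dim {:M}); elim: n M => // n IH M /ltnSE leMn M0.
case: (classic (simple M)) => [sM|nsM].
  have [_ _ /(_ _ sM)[lam [f hf /bij_injsurj[_ fs]]]] := Lsimple.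
  by exists lam, f.
have [U UP] : exists U : submod M, ~ (U = 0%VS :> {vspace M} \/ U = fullv :> {vspace M}).
  by apply: not_all_ex_not => h; apply: nsM.
have s := ses_sub U; have dU := ses_dim s.
have dU0 : (0 < \dim {:sub_mod U})%N.
  rewrite lt0n; apply/negP=> /eqP/zero_dim/zeroP U0; apply: UP; left.
  apply/eqP; rewrite -subv0; apply/subvP=> v /sub_incl_mem[x ->].
  by rewrite (U0 x) linear0 mem0v.
have [||lam [q [hq qs]]] := IH (quot_mod U).
- apply: leq_trans leMn; rewrite -dU; move: dU0.
  by case: (\dim {:sub_mod U}) => // m _; rewrite addSn ltnS leq_addl.
- move/zeroP=> Q0; apply: UP; right; apply/eqP; rewrite eqEsubv subvf /=.
  apply/subvP=> v _; have [x ->] := ses_ker s (Q0 (quot_hom U v)).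
  by rewrite sub_inclE; apply: subvsP.
exists lam, (q \o quot_hom U)%VF; split; first exact: hom_comp (ses_q s) hq.
move=> z; have [y <-] := qs z; have [x <-] := ses_surj s y.
by exists x; rewrite comp_lfunE.
Qed.

Lemma compser_ex M : exists s, filtration L M s.
Proof.
have [n] := ubnP (\dim {:M}); elim: n M => // n IH M /ltnSE leMn.
case: (classic (zero_module M)) => [M0|M0]; first by exists [::]; apply/filt_nil.
have [lam [q [hq qs]]] := top_ex M0; have s := ses_kernel hq qs.
have [|t ft] := IH (sub_mod (ker_sub hq)); last by exists (lam :: t); apply: filt_cons s ft.
apply: leq_trans leMn; rewrite -(ses_dim s).
have : \dim {:L lam} != 0%N.
  by apply/eqP=> /zero_dim; case: (Lam_simple lam).
by rewrite -lt0n; case: (\dim {:L lam}) => // m _; rewrite addnS ltnS leq_addr.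
Qed.

(** [M] is a quotient of [P lam], so its only maximal submodule is the kernel of [r]. *)
Lemma Pcover_surj lam M X (pi : 'Hom(P lam, M)) (r : 'Hom(M, L lam)) (f : 'Hom(X, M)) :
  pi \in homA (P lam) M -> r \in homA M (L lam) -> f \in homA X M ->
  (forall z, exists y, pi y = z) -> (r \o f)%VF <> 0 -> forall z, exists y, f y = z.
Proof.
move=> hpi hr hf spi rf.
have [_ [p hp [/limg_surj sp psup]]] := Pcover lam.
have supS Z (g : 'Hom(Z, P lam)) : g \in homA Z (P lam) -> (p \o g)%VF <> 0 ->
    forall z, exists y, g y = z.
  move=> hg pg; apply/limg_surj; apply: (psup (img_sub hg)) => /=.
  have pgs := simple_surj (Lam_simple lam) (hom_comp hg hp) pg.
  apply/eqP; rewrite eqEsubv subvf; apply/subvP=> v _.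
  have [y] := pgs (p v); rewrite comp_lfunE => yE.
  rewrite -(subrK (g y) v) addrC memv_add ?memv_img ?memvf //.
  by rewrite memv_ker linearB /= yE subrr.
have hrp : (r \o pi)%VF \in homA (P lam) (L lam) := hom_comp hpi hr.
have rp0 : (r \o pi)%VF <> 0.
  move=> E; apply: rf; apply/lfunP=> x; rewrite comp_lfunE.
  by have [y <-] := spi (f x); rewrite (compE E) !zero_lfunE.
have srp := simple_surj (Lam_simple lam) hrp rp0.
have sk := ses_kernel hrp srp.
(* Otherwise [supS] would make the inclusion of this kernel onto and [r \o pi] zero. Hence [p]
   factors through [r \o pi] by a map [h] of [L lam]. *)
have pk0 : (p \o sub_incl (ker_sub hrp))%VF = 0.
  apply: NNPP => /(supS _ _ (ses_i sk)) ks; apply: rp0; apply/lfunP=> x.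
  by have [y <-] := ks x; rewrite (ses_comp sk) zero_lfunE.
have [x|h hh hE] := factor_surj (ses_q sk) hp srp.
  by case/(ses_ker sk) => y ->; rewrite (compE pk0) zero_lfunE.
have s := ses_sub (img_sub hf); set c := quot_hom _ in s.
have hcpi : (c \o pi)%VF \in homA (P lam) (quot_mod (img_sub hf)) := hom_comp hpi (ses_q s).
have scpi z : exists y, (c \o pi)%VF y = z.
  have [y <-] := ses_surj s z; have [x <-] := spi y.
  by exists x; rewrite comp_lfunE.
have sV := ses_kernel hcpi scpi.
(* The kernel of [c \o pi] is the preimage under [pi] of the image of [f]. It is not contained in
   the kernel of [p], so it is all of [P lam]. *)
have gs : forall z, exists y, sub_incl (ker_sub hcpi) y = z.
  apply: supS (ses_i sV) _ => E.
  have [x] := nz_lfun rf; rewrite comp_lfunE => rfx.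
  have [y yE] := spi (f x).
  have [|w wE] := ses_ker sV (y := y).
    rewrite comp_lfunE yE.
    have fx : f x \in (img_sub hf : {vspace M}) by rewrite /= memv_img ?memvf.
    by have [v ->] := sub_incl_mem fx; apply: ses_comp s _.
  have py : p y = 0 by rewrite wE (compE E) zero_lfunE.
  have hi : forall x, h x = 0 -> x = 0.
    apply: simple_inj (Lam_simple lam) hh _ => h0.
    case: (Lam_simple lam) => n0 _; apply: n0; apply/zeroP=> z.
    by have [u <-] := sp z; rewrite -(compE hE) h0 zero_lfunE.
  by apply: rfx; rewrite -yE -comp_lfunE; apply: hi; rewrite (compE hE).
move=> z; have [y yE] := spi z; have [w wE] := gs y.
have [x xE] : exists x, z = sub_incl (img_sub hf) x.
  by apply: (ses_ker s); rewrite -yE -comp_lfunE -wE; apply: ses_comp sV _.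
have /memv_imgP[v _ vE] := subvsP x.
by exists v; rewrite xE sub_inclE vE.
Qed.

Lemma Ptop lam : exists p : 'Hom(P lam, L lam), p \in homA (P lam) (L lam) /\ p <> 0.
Proof.
have [_ [p hp [/limg_surj sp _]]] := Pcover lam; exists p; split=> // p0.
case: (Lam_simple lam) => n0 _; apply: n0; apply/zeroP=> z.
by have [u <-] := sp z; rewrite p0 zero_lfunE.
Qed.

Lemma hom0_PL lam mu : hom0 (P mu) (L lam) <-> lam <> mu.
Proof.
split=> [h E|ne f hf].
  by subst mu; have [p [hp]] := Ptop lam; apply; apply: h.
apply: NNPP => f0; apply: ne.
have fs := simple_surj (Lam_simple lam) hf f0; have sk := ses_kernel hf fs.
have [p [hp p0]] := Ptop mu.
have pk0 : (p \o sub_incl (ker_sub hf))%VF = 0.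
  apply: NNPP => pk.
  have ks : forall z, exists y, sub_incl (ker_sub hf) y = z.
    apply: (Pcover_surj (hom_id (P mu)) hp (ses_i sk)) => [z|//].
    by exists z; rewrite id_lfunE.
  apply: f0; apply/lfunP=> x.
  by have [y <-] := ks x; rewrite (ses_comp sk) zero_lfunE.
have [x|h hh hE] := factor_surj (ses_q sk) hp fs.
  by case/(ses_ker sk) => y ->; rewrite (compE pk0) zero_lfunE.
have h0 : h <> 0.
  by move=> h0; apply: p0; apply/lfunP=> x; rewrite -hE h0 comp_lfunE !zero_lfunE.
have [_ Linj _] := Lsimple; apply: Linj.
apply: (bij_iso hh); first exact: simple_inj (Lam_simple lam) hh h0.
exact: simple_surj (Lam_simple mu) hh h0.
Qed.

(** [P mu] is projective, so Hom(P mu, -) is exact, and [L mu] is the only one of the simples [L nu]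
    to which [P mu] maps nontrivially. *)
Lemma compfactorP M s mu : filtration L M s -> (mu \in s) <-> ~ hom0 (P mu) M.
Proof.
move=> fM; split=> [mus h0|nh].
  by have /hom0_PL := filt_hom0V (@Pproj mu) fM h0 mus; apply.
apply/negPn/negP=> nmus; apply: nh; apply: filt_hom0 fM _ => nu nus.
by apply/hom0_PL=> E; rewrite -E nus in nmus.
Qed.

Lemma Delta_ses lam :
  ses (sub_incl (standard_sub P lam)) (quot_hom (standard_sub P lam) : 'Hom(_, Delta lam)).
Proof. exact: ses_sub. Qed.

Lemma Delta_top lam : exists (R : amod A) (k : 'Hom(R, Delta lam))
    (r : 'Hom(Delta lam, L lam)) s,
  [/\ ses k r, filtration L R s & all (fun mu => (mu < lam)%O) s].
Proof.
have [_ [f [hf [/limg_surj sf [s fs ss]]]]] := qh lam.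
by exists (sub_mod (ker_sub hf)), (sub_incl (ker_sub hf)), f, s; split=> //; apply: ses_kernel.
Qed.

Lemma Delta_wt lam mu : ~ hom0 (P mu) (Delta lam) -> (mu <= lam)%O.
Proof.
have [R [k [r [s [sk fR /allP sl]]]]] := Delta_top lam.
move=> nh; apply/negPn/negP=> nle; apply: nh; apply: hom0_ses sk _ _.
  apply: NNPP => /(compfactorP _ fR)/sl/ltW; by apply/negP.
by apply/hom0_PL=> E; rewrite E lexx in nle.
Qed.

Lemma Delta_wt_refl lam : ~ hom0 (P lam) (Delta lam).
Proof.
have [R [k [r [s [sk _ _]]]]] := Delta_top lam.
by move/(hom0_quot (@Pproj lam) sk)/hom0_PL.
Qed.

(** The kernel of [P lam -> Delta lam] is the trace of [B]. Any map [B -> P lam] lands in it, and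
    followed by [f] becomes a map [B -> N], hence zero. *)
Lemma hom0_Delta_ker lam N : (forall mu, (lam < mu)%O -> hom0 (P mu) N) ->
  hom0 (sub_mod (standard_sub P lam)) N.
Proof.
move=> h f hf; set B := (\big[@dsum K A/@mod0 K A]_(mu | (lam < mu)%O) P mu).
have hB : hom0 B N.
  apply: (big_ind (fun M => hom0 M N)) => [g hg|M M' h1 h2 g hg|mu lemu]; last exact: h.
    by apply/lfunP=> x; rewrite (_ : x = 0) ?linear0 //; apply: thinmx0.
  have [i [j [p [q b]]]] := biprod_dsum M M'.
  apply/lfunP=> x; rewrite -(bi_sumE b x) linearD /=.
  rewrite (compE (h1 _ (hom_comp (bi_i b) hg))) (compE (h2 _ (hom_comp (bi_j b) hg))).
  by rewrite !zero_lfunE addr0.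
have s := Delta_ses lam; set k := sub_incl _ in s.
have le : (trace_space B (P lam) <= k @: lker f)%VS.
  apply: trace_least => g hg; apply/subvP=> _ /memv_imgP[y _ ->].
  have [x|g' hg' gE] := factor_inj (ses_i s) hg (ses_inj s).
    apply: sub_incl_mem; apply: (subvP (trace_sup hg)).
    by rewrite memv_img ?memvf.
  rewrite -gE comp_lfunE memv_img // memv_ker -comp_lfunE.
  by rewrite (hB _ (hom_comp hg' hf)) zero_lfunE.
apply/lfunP=> x; rewrite zero_lfunE.
have : k x \in (k @: lker f)%VS.
  by apply: (subvP le); rewrite /k sub_inclE; apply: subvsP.
case/memv_imgP=> y; rewrite memv_ker => /eqP fy /(inj_eq0 (ses_inj s)) ->.
exact: fy.
Qed.

(** By [hom0_Delta_ker] the only map to be extended in [liftp_crit] is zero. *)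
Lemma liftp_Delta lam N : (forall mu, (lam < mu)%O -> hom0 (P mu) N) ->
  liftp (Delta lam) N.
Proof.
move=> h; apply: liftp_crit (Delta_ses lam) (@Pproj lam) _ => phi hphi.
exists 0; first exact: mem0v.
rewrite (hom0_Delta_ker h hphi).
by apply/lfunP=> x; rewrite comp_lfunE !zero_lfunE.
Qed.

Lemma liftp_DeltaDelta lam mu : ~ (lam < mu)%O -> liftp (Delta lam) (Delta mu).
Proof.
move=> nlt; apply: liftp_Delta => nu lenu; apply: NNPP => /Delta_wt le.
exact/nlt/(lt_le_trans lenu).
Qed.

End QH.

(** * Tilting modules *)

Section QHD.
Variables (K : fieldType) (A : falgType K).
Variables (d : Order.disp_t) (Lam : finPOrderType d) (L P : Lam -> amod A).
Variables (D : cofunctor A) (eta : forall M : amod A, 'Hom(M, D (D M))).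
Implicit Types M N Q X Y Z S U E C T : amod A.
Hypothesis Lsimple : complete_simples L.
Hypothesis Pcover : forall lam, projective_cover (P lam) (L lam).
Hypothesis qh : quasi_hereditary L P.
Hypothesis Dex : exact_cofunctor D.
Hypothesis eta_iso : forall M, eta M \in homA M (D (D M)) /\ bijective (eta M).
Hypothesis eta_nat : forall M N (f : 'Hom(M, N)), f \in homA M N ->
  (cof_map D (cof_map D f) \o eta M = eta N \o f)%VF.
Hypothesis Dsimple : forall S, simple S -> iso (D S) S.

Local Notation Delta := (standard P).
Local Notation Nabla := (fun lam => D (Delta lam)).

Lemma DL lam : iso (D (L lam)) (L lam).
Proof. exact/Dsimple/(Lam_simple Lsimple). Qed.

(** [D] fixes the simple modules and reverses composition series, so [M] and [D M] have the same
    composition factors. *)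
Lemma D_wt mu M : hom0 (P mu) (D M) <-> hom0 (P mu) M.
Proof.
have [s fM] := compser_ex Lsimple M.
have fD := filt_D Dex DL fM.
have E1 := compfactorP Lsimple Pcover mu fM.
have E2 := compfactorP Lsimple Pcover mu fD.
rewrite mem_rev in E2; split=> h; apply: NNPP.
  by move/E1/E2.
by move/E2/E1.
Qed.

Lemma Nabla_wt lam mu : ~ hom0 (P mu) (D (Delta lam)) -> (mu <= lam)%O.
Proof. by move=> h; apply: (Delta_wt Lsimple Pcover qh) => h'; apply/h/D_wt. Qed.

(** * Costandard modules as duals of standard modules *)

Section Costandard.
Variable I : Lam -> amod A.
Hypothesis Ihull : forall lam, injective_hull (I lam) (L lam).
Variable nabla : forall lam, submod (I lam).
Hypothesis nablaP : forall lam, costandard_sub L (nabla lam).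

Lemma no_compfactor lam M : (forall mu, (lam < mu)%O -> hom0 (P mu) M) ->
  forall mu, (lam < mu)%O -> ~ composition_factor L mu M.
Proof.
by move=> h mu ltmu [s fM /(compfactorP Lsimple Pcover mu fM)]; apply; apply: h.
Qed.

Lemma nabla_wt lam mu : (lam < mu)%O -> hom0 (P mu) (sub_mod (nabla lam)).
Proof.
move=> ltmu; have [h _] := nablaP lam; have [s fM] := compser_ex Lsimple (sub_mod (nabla lam)).
apply: NNPP => /(compfactorP Lsimple Pcover mu fM) mus.
by apply: (h mu ltmu); exists s.
Qed.

Lemma nabla_embed lam M (h : 'Hom(M, I lam)) : h \in homA M (I lam) ->
  (forall mu, (lam < mu)%O -> hom0 (P mu) M) -> (forall x, h x = 0 -> x = 0) ->
  exists2 g, g \in homA M (sub_mod (nabla lam)) & (sub_incl (nabla lam) \o g)%VF = h.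
Proof.
move=> hh hM hi; have su := ses_sub (nabla lam).
apply: (factor_inj (ses_i su) hh (ses_inj su)) => x; apply: sub_incl_mem.
have [_ nmax] := nablaP lam.
apply: (subvP (nmax (img_sub hh) _)); last by rewrite /= memv_img ?memvf.
apply: no_compfactor => mu ltmu.
apply: hom0_iso (hM _ ltmu); apply: ses_iso_sub (ses_coker hh hi) (ses_sub _).
Qed.

(** The dual of [r] embeds [L lam] in [D (Delta lam)], and injectivity of [I lam] extends
    [L lam -> I lam] to a map [h]. Its dual is onto by [Pcover_surj], so [h] is injective; by
    weights it lands in [nabla lam]. *)
Lemma DDelta_embed lam : exists g : 'Hom(D (Delta lam), sub_mod (nabla lam)),
  g \in homA (D (Delta lam)) (sub_mod (nabla lam)) /\ forall x, g x = 0 -> x = 0.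
Proof.
have [R [k [r [s [sk fR sl]]]]] := Delta_top qh lam.
have [w hw bw] := DL lam.
have [Iinj [i hi [/lker_inj ii _]]] := Ihull lam.
have hr := ses_q sk; have hDr := cof_hom D hr.
have iDr := ses_inj (D_ses Dex sk).
have [h hh hE] := Iinj _ _ _ _ hDr (proj2 (lker_inj _) iDr) (hom_comp hw hi).
have hDh := cof_hom D hh.
have [g [hg ge eg]] := bij_hom (eta_hom eta_iso (Delta lam)) (@eta_inj _ _ _ _ eta_iso _)
  (@eta_surj _ _ _ _ eta_iso _).
have gs : forall z, exists y, (g \o cof_map D h)%VF y = z.
  have [_ hpi _ spi _ _] := Delta_ses P lam.
  apply: (Pcover_surj Lsimple Pcover hpi hr (hom_comp hDh hg) spi) => E.
  have : cof_map D (h \o cof_map D r)%VF = 0.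
    rewrite cof_comp //; apply/lfunP=> x; rewrite comp_lfunE zero_lfunE.
    have <- : eta (Delta lam) ((g \o cof_map D h)%VF x) = cof_map D h x.
      by rewrite comp_lfunE (compE eg) id_lfunE.
    by rewrite (eta_natE eta_nat) // (compE E) zero_lfunE linear0.
  move/(D_faithful Dex eta_iso eta_nat (hom_comp hDr hh)).
  rewrite hE => iw0; case: (Lam_simple Lsimple lam) => n0 _; apply: n0; apply/zeroP=> z.
  have [_ ws] := bij_injsurj bw; have [y <-] := ws z.
  by apply: ii; rewrite (compE iw0) zero_lfunE.
have ih x : h x = 0 -> x = 0.
  move=> hx; apply: (eta_inj eta_iso).
  apply: (D_surjinj Dex hDh) => [z|]; last by rewrite (eta_natE eta_nat) // hx linear0.
  have [y yE] := gs (g z); exists y.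
  by have := congr1 (eta _) yE; rewrite comp_lfunE !(compE eg) !id_lfunE.
have [|f hf fE] := nabla_embed hh _ ih.
  move=> mu ltmu; by apply: NNPP => /Nabla_wt/(lt_le_trans ltmu); rewrite ltxx.
by exists f; split=> // x fx; apply: ih; rewrite -fE comp_lfunE fx linear0.
Qed.

(** Projectivity lifts [P lam -> L lam] to a map [g] from [P lam] to the dual of [nabla lam]. Its
    dual [e] is nonzero on the essential submodule [L lam], hence injective, so [g] is onto. By
    weights [g] factors through [Delta lam], and the factor dualises to the embedding. *)
Lemma nabla_embed_DDelta lam : exists g : 'Hom(sub_mod (nabla lam), D (Delta lam)),
  g \in homA (sub_mod (nabla lam)) (D (Delta lam)) /\ forall x, g x = 0 -> x = 0.
Proof.
set V := sub_mod (nabla lam); have su := ses_sub (nabla lam).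
set u := sub_incl _ in su.
have [Iinj [i hi [/lker_inj ii iess]]] := Ihull lam.
have [|i' hi' i'E] := nabla_embed hi _ ii.
  by move=> mu ltmu; apply/(hom0_PL Lsimple Pcover) => E; rewrite E ltxx in ltmu.
have [w [w' [hw hw' w'w ww']]] := proj1 (isoP _ _) (DL lam).
have [p [hp p0]] := Ptop Lsimple Pcover lam.
have ii' x : i' x = 0 -> x = 0 by move=> ix; apply: ii; rewrite -(compE i'E) ix linear0.
have hDi := cof_hom D hi'.
have sDi := D_ses Dex (ses_coker hi' ii').
have [g hg gE] := projective_liftp (Pproj Pcover (lam := lam)) sDi (hom_comp hp hw').
have hDg := cof_hom D hg.
pose e := (cof_map D g \o eta V)%VF.
have he : e \in homA V (D (P lam)) := hom_comp (eta_hom eta_iso V) hDg.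
have ei0 : (e \o i')%VF <> 0.
  move=> E; apply: p0.
  have : (cof_map D i' \o g)%VF = 0.
    apply: (D_faithful Dex eta_iso eta_nat (hom_comp hg hDi)).
    rewrite cof_comp //; apply/lfunP=> x; have [y <-] := eta_surj eta_iso x.
    rewrite comp_lfunE (eta_natE eta_nat) //; have := compE E y.
    by rewrite !zero_lfunE /e comp_lfunE.
  rewrite gE => w0; apply/lfunP=> x; rewrite -[p x](id_lfunE) -ww' comp_lfunE.
  by rewrite (compE w0) !zero_lfunE linear0.
have iei := simple_inj (Lam_simple Lsimple lam) (hom_comp hi' he) ei0.
have ie x : e x = 0 -> x = 0.
  move=> ex; pose k := (u \o sub_incl (ker_sub he))%VF.
  have hk : k \in homA _ _ := hom_comp (hom_incl _) (ses_i su).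
  have U0 := iess (img_sub hk).
  have : u x \in (img_sub hk : {vspace I lam}).
    have [y ->] : exists y, x = sub_incl (ker_sub he) y.
      by apply: sub_incl_mem; rewrite /= memv_ker ex.
    by rewrite -comp_lfunE /= memv_img ?memvf.
  rewrite U0 ?memv0 => [/eqP|]; first exact: ses_inj su _.
  apply/eqP; rewrite -subv0; apply/subvP=> v; rewrite memv_cap /=.
  case/andP=> /memv_imgP[y _ ->] /memv_imgP[z _].
  rewrite -(compE i'E) comp_lfunE => /(inj_eq0 (ses_inj su)) yz.
  have ey : e (sub_incl (ker_sub he) y) = 0.
    by apply/eqP; rewrite -memv_ker sub_inclE; apply: (@subvsP _ _ (ker_sub he)).
  rewrite memv0 yz (_ : z = 0) ?linear0 //.
  by apply: iei; rewrite comp_lfunE -yz.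
have gs : forall z, exists y, g y = z.
  have sc := ses_sub (img_sub hg); set c := quot_hom _ in sc.
  have c0 : c = 0.
    apply: (D_faithful Dex eta_iso eta_nat (ses_q sc)).
    apply/lfunP=> x; rewrite zero_lfunE; have [y yE] := eta_surj eta_iso (cof_map D c x).
    rewrite -yE (ie y) ?linear0 // /e comp_lfunE yE.
    rewrite -(@comp_lfunE _ _ _ _ (cof_map D g)) -cof_comp ?(ses_q sc) //.
    rewrite (_ : (c \o g)%VF = 0) ?D_0 ?zero_lfunE //.
    apply/lfunP=> v; rewrite comp_lfunE zero_lfunE.
    have gv : g v \in (img_sub hg : {vspace _}) by rewrite /= memv_img ?memvf.
    by have [t ->] := sub_incl_mem gv; apply: ses_comp sc _.
  move=> z; have [x ->] : exists x, z = sub_incl (img_sub hg) x.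
    by apply: (ses_ker sc); rewrite c0 zero_lfunE.
  by rewrite sub_inclE; have /memv_imgP[v _ ->] := subvsP x; exists v.
have sD := Delta_ses P lam.
have gk : (g \o sub_incl (standard_sub P lam))%VF = 0.
  apply: (hom0_Delta_ker (N := D V)); last exact: hom_comp (ses_i sD) hg.
  by move=> mu ltmu; apply/D_wt; apply: nabla_wt.
have [x|g' hg' g'E] := factor_surj (ses_q sD) hg (ses_surj sD).
  by case/(ses_ker sD) => y ->; rewrite (compE gk) zero_lfunE.
have g's z : exists y, g' y = z.
  by have [y <-] := gs z; rewrite -(compE g'E); exists (quot_hom (standard_sub P lam) y).
exists (cof_map D g' \o eta V)%VF; split.
  by apply: hom_comp (eta_hom eta_iso V) (cof_hom D hg').
by move=> x; rewrite comp_lfunE => /(D_surjinj Dex hg' g's)/(eta_inj eta_iso).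
Qed.

Lemma nabla_iso lam : iso (sub_mod (nabla lam)) (D (Delta lam)).
Proof.
have [f [hf fi]] := nabla_embed_DDelta lam; have [g [hg gi]] := DDelta_embed lam.
exact: bij_iso hf fi (inj_dim_surj fi (inj_dim gi)).
Qed.

End Costandard.

(** * Ext-characterisation of the categories F(Delta) and F(nabla) *)

Definition FDelta M := has_filtration Delta M.
Definition FNabla M := has_filtration Nabla M.

(** Weights settle the case where [lam < mu] fails; otherwise [D] exchanges the roles of [lam] and
    [mu]. *)
Lemma liftp_Delta_Nabla lam mu : liftp (Delta lam) (D (Delta mu)).
Proof.
case: (boolP (lam < mu)%O) => [ltlm|nlt].
  apply: liftp_retract1 (iso_retract (DD_iso eta_iso _)) _.
  apply: (liftp_DD Dex eta_iso eta_nat).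
  apply: liftp_Delta Pcover _ _ _ => nu ltnu; apply: NNPP => /Nabla_wt le.
  by have := lt_trans (lt_le_trans ltnu le) ltlm; rewrite ltxx.
apply: liftp_Delta Pcover _ _ _ => nu ltnu; apply: NNPP => /Nabla_wt le.
by move/negP: nlt; apply; apply: lt_le_trans ltnu le.
Qed.

Local Notation l2e := (liftp_extp Dex eta_iso eta_nat).

Lemma FDelta_extp M mu : FDelta M -> extp M (D (Delta mu)).
Proof.
by move=> [s fM]; apply: filt_extp fM _ => lam _; apply/l2e/liftp_Delta_Nabla.
Qed.

Lemma FNabla_liftp M lam : FNabla M -> liftp (Delta lam) M.
Proof. by move=> [s fM]; apply: filt_liftp fM _ => mu _; apply: liftp_Delta_Nabla. Qed.

Lemma FDelta_FNabla M N : FDelta M -> FNabla N -> extp M N.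
Proof.
by move=> [s fM] fN; apply: filt_extp fM _ => lam _; apply/l2e/FNabla_liftp.
Qed.

Lemma Delta_ker_FDelta lam : FDelta (sub_mod (standard_sub P lam)).
Proof. by have [[s fs _] _] := qh lam; exists s. Qed.

(* For lam minimal among the tops of M, the obstruction to lifting M -> L lam to Delta lam
   vanishes; the kernel of the lift again satisfies the hypothesis. *)
Lemma extp_FDelta M : (forall mu, extp M (D (Delta mu))) -> FDelta M.
Proof.
have [n] := ubnP (\dim {:M}); elim: n M => // n IH M /ltnSE leMn eM.
case: (classic (zero_module M)) => [M0|M0]; first by exists [::]; apply/filt_nil.
have {M0}[lam [q [hq qs]] lmin] : exists2 lam,
    (exists q : 'Hom(M, L lam), q \in homA M (L lam) /\ forall z, exists y, q y = z) &
    forall mu, (mu < lam)%O -> hom0 M (L mu).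
  have [lam0 Q0] := top_ex Lsimple M0.
  have [lam Ql lmin] := ex_minimal (Q := fun lam => exists q : 'Hom(M, L lam),
    q \in homA M (L lam) /\ forall z, exists y, q y = z) Q0.
  exists lam => // mu ltmu f hf; apply: NNPP => f0; apply: (lmin mu ltmu).
  by exists f; split=> //; apply: simple_surj (Lam_simple Lsimple mu) hf f0.
(* Dualising [Delta mu -> L mu] embeds [L mu] in [D (Delta mu)]. The cokernel has factors below
   [mu], hence below [lam], and receives no nonzero map from [M]. *)
have eL mu : (mu < lam)%O -> extp M (L mu).
  move=> ltmu; have [R [k [r [s [sk fR /allP sl]]]]] := Delta_top qh mu.
  apply: extp_retract2 (iso_retract (iso_sym (DL mu))) _.
  apply: extp_hom0 (D_ses Dex sk) _ (eM mu).
  apply: filt_hom0 (filt_D Dex DL fR) _ => nu; rewrite mem_rev => /sl ltnu.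
  exact/lmin/(lt_trans ltnu).
have [R [k [r [s [sk fR /allP sl]]]]] := Delta_top qh lam.
have lR : liftp M R by apply: filt_liftp fR _ => mu /sl/eL; apply: extp_liftp.
have [g hg gE] := lR _ _ _ _ _ sk hq.
have [_ hpi _ spi _ _] := Delta_ses P lam.
have q0 : q <> 0.
  move=> q0; case: (Lam_simple Lsimple lam) => n0 _; apply: n0; apply/zeroP=> z.
  by have [y <-] := qs z; rewrite q0 zero_lfunE.
have gs : forall z, exists y, g y = z.
  by apply: (Pcover_surj Lsimple Pcover hpi (ses_q sk) hg spi); rewrite gE.
have sg := ses_kernel hg gs; set U := sub_mod _ in sg; set u := sub_incl _ in sg.
have [t ht tE] := projective_liftp (Pproj Pcover (lam := lam)) sg hpi.
have sD := Delta_ses P lam; set k' := sub_incl _ in sD.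
(* [E] contains [U] as a summand and is an extension of [M] by the kernel of [P lam -> Delta lam].
   Neither end has extensions by the modules [D (Delta mu)]. *)
have [E [a [c [sac rU]]]] := ses_syzygy sD sg ht tE.
have fU : FDelta U.
  apply: IH => [|mu].
    apply: leq_trans leMn; rewrite -(ses_dim sg).
    have : \dim {:Delta lam} != 0%N.
      apply/eqP=> /zero_dim/zeroP D0; apply: q0; apply/lfunP=> x.
      by rewrite -gE comp_lfunE (D0 (g x)) linear0 zero_lfunE.
    by rewrite -lt0n; case: (\dim {:Delta lam}) => // m _; rewrite addnS ltnS leq_addr.
  have eUP := extp_ses1 sac (FDelta_extp (mu := mu) (Delta_ker_FDelta lam)) (eM mu).
  exact/l2e/(liftp_retract1 rU (extp_liftp eUP)).
by case: fU => t' ft; exists (lam :: t'); apply: filt_cons sg ft.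
Qed.

Lemma FDelta_iso M N : iso M N -> FDelta M -> FDelta N.
Proof. by move=> iMN [s fM]; exists s; apply: filt_iso fM. Qed.

Lemma D_FDelta M : FDelta M -> FNabla (D M).
Proof. by move=> [s fM]; exists (rev s); apply: filt_D fM => // lam; apply: iso_refl. Qed.

(** The nontrivial direction is [extp_FDelta] for [D M]. *)
Lemma FNablaP M : FNabla M <-> forall lam, liftp (Delta lam) M.
Proof.
split=> [fM lam|lM]; first exact: FNabla_liftp.
have /D_FDelta[s fs] : FDelta (D M).
  by apply: extp_FDelta => mu; apply: (liftp_D Dex eta_iso eta_nat).
by exists s; apply: filt_iso fs; apply: iso_sym; apply: DD_iso.
Qed.

Lemma FDeltaP M : FDelta M <-> forall mu, liftp M (D (Delta mu)).
Proof.
split=> [fM mu|lM]; first exact/extp_liftp/FDelta_extp.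
by apply: extp_FDelta => mu; apply: l2e.
Qed.

Lemma FDelta_ses M N Q (i : 'Hom(M, N)) (q : 'Hom(N, Q)) :
  ses i q -> FDelta M -> FDelta Q -> FDelta N.
Proof. by move=> s [t ft] [r fr]; exists (r ++ t); apply: filt_cat s fr ft. Qed.

Definition tilt M := FDelta M /\ FNabla M.

(** By [FDeltaP] and [FNablaP] both conditions are vanishing of Ext^1, which passes to summands. *)
Lemma tilt_retract N M : retract N M -> tilt M -> tilt N.
Proof.
move=> rNM [/FDeltaP fD /FNablaP fN]; split.
  by apply/FDeltaP=> mu; apply: liftp_retract1 rNM _.
apply/FNablaP=> lam; apply: extp_liftp; apply: extp_retract2 rNM _.
exact: l2e.
Qed.

Lemma tilt_D M : tilt M -> tilt (D M).
Proof.
move=> [/FDeltaP fD /FNablaP fN]; split.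
  by apply/FDeltaP=> mu; apply: (liftp_DD Dex eta_iso eta_nat).
apply/FNablaP=> lam; apply: liftp_retract1 (iso_retract (DD_iso eta_iso _)) _.
exact: (liftp_DD Dex eta_iso eta_nat).
Qed.

(* The maps phi represent classes in Ext^1(Delta lam, M), all of which die in N. *)
Lemma universal_ext lam M (fs : seq 'Hom(sub_mod (standard_sub P lam), M)) :
  (forall phi, phi \in fs -> phi \in homA (sub_mod (standard_sub P lam)) M) ->
  exists N C (a : 'Hom(M, N)) (b : 'Hom(N, C)) s,
    [/\ ses a b, filtration Delta C s, all (pred1 lam) s &
        forall phi, phi \in fs -> exists2 psi, psi \in homA (P lam) N &
          (psi \o sub_incl (standard_sub P lam))%VF = (a \o phi)%VF].
Proof.
have sD := Delta_ses P lam.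
have [n] := ubnP (size fs); elim: n M fs => // n IH M [|phi fs] /=.
  move=> _ _.
  exists M, (mod0 A), \1%VF, 0, [::]; split=> //; last exact/filt_nil/mod0_zero.
  exact: ses_mod0.
move=> /ltnSE lefs hfs; have hphi := hfs _ (mem_head _ _).
have [E [a [b [psi [sab hpsi psiE]]]]] := pushout sD hphi.
(* The remaining maps are pushed along [a] into [E], where [phi] already extends to [P lam]. *)
pose fs' := [seq (a \o f)%VF | f <- fs].
have [|f'|N [C [a' [b' [s [sab' fC sl H]]]]]] := IH E fs'.
  by rewrite size_map.
  case/mapP=> f ff ->; apply: hom_comp (ses_i sab); apply: hfs.
  by rewrite inE ff orbT.
have [C' [c [i [q [sc siq]]]]] := ses_comp2 sab sab'.
exists N, C', (a' \o a)%VF, c, (s ++ [:: lam]); split=> //.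
- exact: filt_cat siq fC (filt_one (iso_refl _)).
- by rewrite all_cat sl /= eqxx.
move=> f; rewrite inE => /orP[/eqP->|ff].
  exists (a' \o psi)%VF; first exact: hom_comp (ses_i sab').
  by rewrite -!comp_lfunA psiE.
have [|psi' h' E'] := H (a \o f)%VF; first by apply/mapP; exists f.
by exists psi' => //; rewrite E' comp_lfunA.
Qed.

(** Apply [universal_ext] to a basis of the maps [Kl -> M]: all of them then extend to [P lam]
    inside [N]. *)
Lemma universal_ext_liftp lam M : exists N C (a : 'Hom(M, N)) (b : 'Hom(N, C)) s,
  [/\ ses a b, filtration Delta C s, all (pred1 lam) s & liftp (Delta lam) N].
Proof.
set Kl := sub_mod (standard_sub P lam).
have [|N [C [a [b [s [sab fC sl H]]]]]] := @universal_ext lam M (vbasis (homA Kl M)).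
  by move=> phi; apply: vbasis_mem.
exists N, C, a, b, s; split=> //.
have sD := Delta_ses P lam; set k := sub_incl _ in sD H.
have ext phi : phi \in homA Kl M ->
    exists2 psi, psi \in homA (P lam) N & (psi \o k)%VF = (a \o phi)%VF.
  move=> /coord_vbasis ->; elim/big_rec: _ => [|i g _ [psi hpsi psiE]].
    exists 0; rewrite ?mem0v //; apply/lfunP=> x.
    by rewrite !comp_lfunE !zero_lfunE linear0.
  have [|psi' hpsi' psiE'] := H (vbasis (homA Kl M))`_i.
    by rewrite mem_nth // size_tuple.
  exists (coord (vbasis (homA Kl M)) i phi *: psi' + psi).
    by apply: memvD => //; apply: memvZ.
  apply/lfunP=> x; rewrite !(comp_lfunE, add_lfunE, scale_lfunE).
  by rewrite linearP /= (compE psiE) (compE psiE') !comp_lfunE.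
(* The image in [C] of a map [phi : Kl -> N] extends to [P lam] because Ext^1(Delta lam, Delta lam)
   = 0. Subtracting a lift [e'] of this extension leaves a map into [M]. *)
apply: (liftp_crit sD (@Pproj _ _ _ _ _ _ Pcover lam)) => phi hphi.
have lC : liftp (Delta lam) C.
  apply: filt_liftp fC _ => mu /(allP sl)/eqP->.
  by apply: liftp_DeltaDelta Lsimple Pcover qh _ _ _; rewrite ltxx.
have [e he eE] := l2e lC sD (hom_comp hphi (ses_q sab)).
have [e' he' e'E] := projective_liftp (@Pproj _ _ _ _ _ _ Pcover lam) sab he.
have hd : (phi - (e' \o k))%VF \in homA Kl N.
  by apply: memvB => //; apply: hom_comp (ses_i sD) he'.
have [x|f hf fE] := factor_inj (ses_i sab) hd (ses_inj sab).
  apply: (ses_ker sab); rewrite !(add_lfunE, opp_lfunE, comp_lfunE) linearB /=.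
  by rewrite (compE e'E) (compE eE) comp_lfunE subrr.
have [psi hpsi psiE] := ext f hf.
exists (psi + e')%VF; first exact: memvD.
apply/lfunP=> x; rewrite comp_lfunE add_lfunE (compE psiE) fE.
by rewrite !(add_lfunE, opp_lfunE, comp_lfunE) subrK.
Qed.

(** [S] is an upper set of weights already dealt with. A maximal weight [lam] outside [S] is added
    by a universal extension. This does not disturb [x] in [S]: Ext^1(Delta x, Delta lam) vanishes
    unless [x < lam], which would put [lam] in [S]. *)
Lemma tilting_hull_aux (S : {set Lam}) M :
  (forall x y, x \in S -> (x < y)%O -> y \in S) ->
  (forall x, x \in S -> liftp (Delta x) M) ->
  exists T C (a : 'Hom(M, T)) (b : 'Hom(T, C)),
    [/\ ses a b, FDelta C & forall lam, liftp (Delta lam) T].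
Proof.
have [n] := ubnP #|~: S|; elim: n S M => // n IH S M /ltnSE leSn upS lS.
case: (classic (exists x, x \notin S)) => [[x0 x0S]|nS]; last first.
  exists M, (mod0 A), \1%VF, 0; split=> [||lam]; first exact: ses_mod0.
    by exists [::]; apply/filt_nil/mod0_zero.
  by apply: lS; apply/negPn/negP=> lamS; apply: nS; exists lam.
have [lam lamS lmax] := ex_maximal (Q := fun x => x \notin S) x0S.
have [N [C [a [b [s [sab fC /allP sl lN]]]]]] := universal_ext_liftp lam M.
have [|||T [C' [a' [b' [sab' fC' lT]]]]] := IH (lam |: S) N.
- apply: leq_trans leSn; apply: proper_card; apply/properP; split.
    by apply/subsetP=> x; rewrite !inE negb_or => /andP[].
  by exists lam; rewrite !inE ?eqxx.
- move=> x y; rewrite !inE => /orP[/eqP->|xS] lt; apply/orP; right.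
    by apply/negPn/negP; apply: lmax.
  exact: upS lt.
- move=> x; rewrite !inE => /orP[/eqP->//|xS].
  apply: liftp_ses2 sab (lS x xS) _; apply: filt_liftp fC _ => mu /sl/eqP->.
  apply: (liftp_DeltaDelta Lsimple Pcover qh) => lt.
  by move/negP: lamS; apply; apply: upS lt.
have [C'' [c [i [q [sc siq]]]]] := ses_comp2 sab sab'.
exists T, C'', (a' \o a)%VF, c; split=> //.
by apply: FDelta_ses siq _ fC'; exists s.
Qed.

Lemma tilting_hull M : FDelta M -> exists T C (a : 'Hom(M, T)) (b : 'Hom(T, C)),
  [/\ ses a b, FDelta C & tilt T].
Proof.
move=> fM; have [x y|x|T [C [a [b [sab fC lT]]]]] := @tilting_hull_aux set0 M.
- by rewrite inE.
- by rewrite inE.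
exists T, C, a, b; split=> //; split; first exact: FDelta_ses sab fM fC.
exact/FNablaP.
Qed.

(** Ext^1(Delta lam, Delta nu) = 0 unless [lam < nu], so the lowest factor [Delta lam] splits off
    from the part of the filtration below it. *)
Lemma Delta_bottom M s lam : filtration Delta M s -> lam \in s ->
  (forall mu, mu \in s -> ~ (lam < mu)%O) ->
  exists Q (i : 'Hom(Delta lam, M)) (q : 'Hom(M, Q)), ses i q /\ FDelta Q.
Proof.
elim: s M => // mu s IH M fM.
have [U [i [q [sq fU]]]] := filt_consE fM.
case: (boolP (lam \in s)) => [lams _ lmax|lams].
  have [nu nus|Q [j [r [sr fQ]]]] := IH U fU lams.
    by apply: lmax; rewrite inE nus orbT.
  have [C [c [i' [q' [sc si]]]]] := ses_comp2 sr sq.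
  exists C, (i \o j)%VF, c; split=> //; apply: FDelta_ses si fQ _.
  by exists [:: mu]; apply/filt_one/iso_refl.
rewrite inE (negPf lams) orbF => /eqP El; subst mu => lmax.
have lU : liftp (Delta lam) U.
  apply: filt_liftp fU _ => nu nus; apply: (liftp_DeltaDelta Lsimple Pcover qh).
  by apply: lmax; rewrite inE nus orbT.
have [h hh hE] := lU _ _ _ _ _ sq (hom_id _).
have [Q [j [r b]]] := retract_compl hh (ses_q sq) hE.
exists Q, h, r; split; first exact: ses_biprod b.
have iU := ses_iso_sub sq (ses_biprod (biprod_swap b)).
by apply: FDelta_iso iU _; exists s.
Qed.

Lemma filt_wt M s nu : filtration Delta M s ->
  ~ hom0 (P nu) M -> exists2 mu, mu \in s & (nu <= mu)%O.
Proof.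
move=> fM nh; apply: NNPP => ne; apply: nh; apply: filt_hom0 fM _ => mu mus.
apply: NNPP => /(Delta_wt Lsimple Pcover qh) le; apply: ne; by exists mu.
Qed.

Lemma filt_wtV M s mu : filtration Delta M s -> mu \in s -> ~ hom0 (P mu) M.
Proof.
move=> fM mus h0; apply: (Delta_wt_refl Lsimple Pcover qh (lam := mu)).
exact: filt_hom0V (@Pproj _ _ _ _ _ _ Pcover mu) fM h0 mus.
Qed.

(* X and D X have the same weights, hence a common Delta lam at the bottom; extending the
   two embeddings of Delta lam gives maps X -> D X -> X whose composites are not nilpotent. *)
Lemma indec_tilt_selfdual X : indecomposable X -> tilt X -> iso (D X) X.
Proof.
move=> Xi tX; have tDX := tilt_D tX; have DXi := D_indec Dex eta_iso Xi.
have [[s fs] nX] := tX; have [[t ft] nDX] := tDX.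
have [lam lams lmax] : exists2 lam, lam \in s & forall mu, mu \in s -> ~ (lam < mu)%O.
  case: s fs => [/filt_nil|x0 s _]; first by case: Xi.
  have [lam lams lmax] := ex_maximal (Q := fun x => x \in x0 :: s) (mem_head _ _).
  by exists lam => // mu mus /lmax.
have ts mu : mu \in t -> exists2 nu, nu \in s & (mu <= nu)%O.
  by move=> mut; apply: (filt_wt fs) => h; apply: (filt_wtV ft mut); apply/D_wt.
have [mu mut lemu] : exists2 mu, mu \in t & (lam <= mu)%O.
  by apply: (filt_wt ft) => /D_wt; apply: filt_wtV fs lams.
(* The factor [mu] of [D X] lies above [lam] and, as [X] and [D X] have the same weights, below some
   [nu] in [s]. Maximality of [lam] gives [mu = lam]. *)
have lamt : lam \in t.
  suff -> : lam = mu by [].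
  have [nu nus lenu] := ts mu mut; apply/eqP; rewrite eq_le lemu /=.
  apply/negPn/negP=> nle; apply: (lmax nu nus); apply: lt_le_trans lenu.
  by rewrite lt_leAnge lemu.
have tmax nu : nu \in t -> ~ (lam < nu)%O.
  by move=> nut lt; have [k ks le] := ts nu nut; apply: (lmax k ks); apply: lt_le_trans lt le.
have [Q [i [q [sq fQ]]]] := Delta_bottom fs lams lmax.
have [Q' [j [q' [sq' fQ']]]] := Delta_bottom ft lamt tmax.
have [f hf fE] := FDelta_FNabla fQ nDX sq (ses_i sq').
have [g hg gE] := FDelta_FNabla fQ' nX sq' (ses_i sq).
have [x0 x00] : exists x : Delta lam, x <> 0.
  apply: nonzeroP => /zeroP D0; apply: (Delta_wt_refl Lsimple Pcover qh (lam := lam)).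
  by move=> h hh; apply/lfunP=> x; rewrite zero_lfunE; apply: D0.
(* [g \o f] fixes the nonzero vector [i x0], which excludes the second alternative of [indec_local];
   likewise [f \o g] fixes [j x0]. *)
have gfi x : (g \o f)%VF x = 0 -> x = 0.
  have [fx|fx] := indec_local Xi (hom_comp hf hg); first exact: fx.
  by case: x00; apply: (ses_inj sq); apply: fx; rewrite comp_lfunE (compE fE) (compE gE).
have fgi x : (f \o g)%VF x = 0 -> x = 0.
  have [fx|fx] := indec_local DXi (hom_comp hg hf); first exact: fx.
  by case: x00; apply: (ses_inj sq'); apply: fx; rewrite comp_lfunE (compE gE) (compE fE).
have fi x : f x = 0 -> x = 0.
  by move=> fx; apply: gfi; rewrite comp_lfunE fx linear0.
have gi x : g x = 0 -> x = 0.
  by move=> gx; apply: fgi; rewrite comp_lfunE gx linear0.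
exact: bij_iso hg gi (inj_dim_surj gi (inj_dim fi)).
Qed.

Lemma tilt_selfdual X : tilt X -> iso (D X) X.
Proof.
have [n] := ubnP (\dim {:X}); elim: n X => // n IH X /ltnSE leXn tX.
case: (classic (zero_module X)) => [X0|X0].
  exact: zero_isoT (D_zero Dex X0) X0.
case: (classic (indecomposable X)) => [Xi|nXi]; first exact: indec_tilt_selfdual.
have [N [Q [i [j [p [q [b ltN ltQ]]]]]]] := decomposable X0 nXi.
have [rN rQ] := biprod_retract b.
apply: biprod_iso2 (D_biprod Dex b) b _ _; apply: IH.
- exact: leq_trans ltN leXn.
- exact: tilt_retract rN tX.
- exact: leq_trans ltQ leXn.
- exact: tilt_retract rQ tX.
Qed.

End QHD.

(** * The regular module *)

Section Regular.
Variables (K : fieldType) (A : falgType K).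

Fact reg_linr (a : A) : linear ( *%R a).
Proof. by move=> k x y; rewrite mulrDr scalerAr. Qed.

Fact reg_linl (x : A) : linear (fun a : A => a * x).
Proof. by move=> k a b; rewrite mulrDl scalerAl. Qed.

Definition regular : amod A :=
  mk_amod reg_linr reg_linl (@mul1r A) (fun a b v => esym (mulrA a b v)).

Lemma regularE (a x : A) : act regular a x = a * x.
Proof. exact: mk_amodE. Qed.

Lemma regular_map (M : amod A) (x : M) : exists2 f : 'Hom(regular, M),
  f \in homA regular M & forall a : A, f a = act M a x.
Proof.
apply: (@ex_hom _ _ regular M (fun a : A => act M a x)) => [k a b|a b].
  by rewrite linearP add_lfunE scale_lfunE.
by rewrite regularE actM comp_lfunE.
Qed.

Lemma regular_projective : projective regular.
Proof.
move=> N Q g f hg /limg_surj gs hf.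
have [y yE] := gs (f (1 : A)); have [h hh hE] := regular_map y.
exists h => //; apply/lfunP=> a; rewrite comp_lfunE hE (homAE _ _ hg) yE.
by rewrite -(homAE _ _ hf) regularE mulr1.
Qed.

(** [cog] speaks of maps into [X]; the element [x] becomes the map from the regular module that
    sends 1 to [x]. *)
Lemma cog_elt (X T : amod A) x : cog X T ->
  (forall phi, phi \in homA X T -> phi x = 0) -> x = 0.
Proof.
move=> c xT; have [f hf fE] := regular_map x.
have f0 : f = 0.
  apply: c => // phi hphi; apply/lfunP=> a; rewrite comp_lfunE zero_lfunE fE.
  by rewrite (homAE _ _ hphi) xT // linear0.
by rewrite -(id_lfunE x) -(act1 X) -fE f0 zero_lfunE.
Qed.

End Regular.

(** * Krull-Schmidt *)

Section KrullSchmidt.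
Variables (K : fieldType) (A : falgType K).
Implicit Types M N Q X Y Z T : amod A.

(* Endomorphisms that are sums of endomorphisms factoring through modules in C; the
   identity is one of them iff M is a summand of a finite sum of modules in C. *)
Inductive factsum (C : amod A -> Prop) M : 'End(M) -> Prop :=
  | Factsum0 : factsum C 0
  | FactsumD Y (f : 'Hom(M, Y)) (g : 'Hom(Y, M)) r : C Y -> f \in homA M Y ->
      g \in homA Y M -> factsum C r -> factsum C ((g \o f) + r)%VF.

Definition in_add (C : amod A -> Prop) M : Prop := factsum C (\1%VF : 'End(M)).

Lemma factsum_hom C M (r : 'End(M)) : factsum C r -> r \in homA M M.
Proof.
by elim=> [|Y f g {}r _ hf hg _ IH]; [exact: mem0v | apply/memvD/IH/hom_comp].
Qed.

Lemma factsum_add C M (r r' : 'End(M)) :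
  factsum C r -> factsum C r' -> factsum C (r + r').
Proof.
move=> fr fr'; elim: fr => [|Y f g {}r CY hf hg _ IH]; first by rewrite add0r.
by rewrite -addrA; apply: FactsumD.
Qed.

Lemma factsum_comp C M N (r : 'End(M)) (f : 'Hom(N, M)) (g : 'Hom(M, N)) :
  f \in homA N M -> g \in homA M N -> factsum C r -> factsum C (g \o (r \o f))%VF.
Proof.
move=> hf hg; elim=> [|Y f' g' {}r CY hf' hg' _ IH].
  rewrite (_ : (g \o (0 \o f))%VF = 0); first exact: Factsum0.
  by apply/lfunP=> x; rewrite !comp_lfunE !zero_lfunE linear0.
rewrite (_ : _ \o _ = ((g \o g') \o (f' \o f)) + (g \o (r \o f)))%VF.
  by apply: FactsumD CY _ _ IH; apply: hom_comp.
by apply/lfunP=> x; rewrite !(comp_lfunE, add_lfunE) linearD.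
Qed.

Lemma factsum_trans C C' M (r : 'End(M)) :
  (forall Y, C Y -> in_add C' Y) -> factsum C r -> factsum C' r.
Proof.
move=> CC'; elim=> [|Y f g {}r /CC' aY hf hg _ IH]; first exact: Factsum0.
apply: factsum_add IH; rewrite -[f]comp_lfun1l.
exact: factsum_comp aY.
Qed.

Lemma retract_in_add C N M : C M -> retract N M -> in_add C N.
Proof.
move=> CM [i [p [hi hp pi]]]; rewrite /in_add -pi -[(p \o i)%VF]addr0.
exact: FactsumD (Factsum0 _ _).
Qed.

Lemma in_add_retract C N M : retract N M -> in_add C M -> in_add C N.
Proof. by move=> r aM; apply: (factsum_trans _ (retract_in_add (erefl M) r)) => Y <-. Qed.

Lemma in_add_biprod C N M Q i j p q : @biprod K A M N Q i j p q ->
  in_add C M -> in_add C N -> in_add C Q.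
Proof.
move=> [hi hj hp hq _ _ E] aM aN; rewrite /in_add -E.
by apply: factsum_add; rewrite -[X in (_ \o X)%VF]comp_lfun1l; apply: factsum_comp.
Qed.

(** The endomorphism ring of [X] is local, so some summand of the identity is bijective, and [X]
    splits off the module through which it factors. *)
Lemma indec_in_add C X : indecomposable X -> in_add C X -> exists2 Y, C Y & retract X Y.
Proof.
move=> Xi; rewrite /in_add.
(* The induction needs the identity generalised to an injective endomorphism [u]. *)
have: forall x, (\1%VF : 'End(X)) x = 0 -> x = 0 by move=> x; rewrite id_lfunE.
move: (\1%VF : 'End(X)) => u ui fu; elim: fu ui => [|Y f g r CY hf hg fr IH] ui.
  by case: Xi => X0 _; case: X0; apply/zeroP=> x; apply: ui; rewrite zero_lfunE.
set u1 := ((g \o f) + r)%VF in ui.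
have hu : u1 \in homA X X by apply: memvD; [apply: hom_comp|apply: factsum_hom fr].
have [v [hv vu uv]] := bij_hom hu ui (inj_dim_surj ui (leqnn _)).
have hvgf : (v \o (g \o f))%VF \in homA X X by apply: hom_comp hv; apply: hom_comp.
have [wi|wi] := indec_local Xi hvgf.
  exists Y => //; have [w [hw wl _]] := bij_hom hvgf wi (inj_dim_surj wi (leqnn _)).
  exists f, (w \o (v \o g))%VF; split=> //; first by do 2!apply: hom_comp => //.
  by rewrite -wl !comp_lfunA.
apply: IH => x rx; apply: wi; rewrite 2!comp_lfunE -[RHS](id_lfunE x) -vu comp_lfunE.
by rewrite /u1 add_lfunE rx addr0 comp_lfunE.
Qed.

(** Membership is [List.In] because modules carry no decidable equality. *)
Fixpoint indep (s : seq (amod A)) : Prop :=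
  if s is X :: s' then
    [/\ indecomposable X, forall Y, List.In Y s' -> ~ iso X Y & indep s']
  else True.

Definition dsums (s : seq (amod A)) : amod A := foldr (@dsum K A) (mod0 A) s.

Lemma retract_dsums Y s : List.In Y s -> retract Y (dsums s).
Proof.
elim: s => //= X s IH Ys; have [i [j [p [q b]]]] := biprod_dsum X (dsums s).
have [r1 r2] := biprod_retract b.
by case: Ys => [<-//|/IH r]; apply: retract_trans r r2.
Qed.

Lemma mod0_retract M : retract (mod0 A) M.
Proof.
exists 0, 0; split; try exact: mem0v.
have Z := proj1 (zeroP (mod0 A)) (mod0_zero A).
by apply/lfunP=> x; rewrite [LHS]Z [RHS]Z.
Qed.

(** Write [M] as the sum of [X] and [Q]. A member [Y] of the tail is a summand of [X] or of [Q], and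
    not of [X] since the two are not isomorphic; so the induction continues in [Q]. *)
Lemma indep_retract s M : indep s -> (forall Y, List.In Y s -> retract Y M) ->
  retract (dsums s) M.
Proof.
elim: s M => [|X s IH] M /=; first by move=> _ _; apply: mod0_retract.
move=> [Xi Xs si] sM; have [i [p [hi hp pi]]] := sM X (or_introl erefl).
have [Q [j [q b]]] := retract_compl hi hp pi; have [_ hj _ hq _ _ _] := b.
have indec_in Z t : indep t -> List.In Z t -> indecomposable Z.
  by elim: t => //= Z' t IHt [h1 _ h3] [<- //|]; apply: IHt.
have [iS [pS [hiS hpS pSE]]] : retract (dsums s) Q.
  apply: IH => // Y Ys; have Yi := indec_in _ _ si Ys.
  have aM : in_add (fun Z => Z = X \/ Z = Q) M.
    by apply: in_add_biprod b _ _; apply: retract_in_add (retract_refl _); [left|right].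
  have [Z [->|->] //] := indec_in_add Yi (in_add_retract (sM Y (or_intror Ys)) aM).
  move/retract_iso_indec => h; case: (Xs Y Ys); apply/iso_sym/h => //.
  by case: Yi.
have [i' [j' [p' [q' b']]]] := biprod_dsum X (dsums s).
have [hi' hj' hp' hq' _ _ _] := b'.
exists ((i \o p') + (j \o (iS \o q')))%VF, ((i' \o p) + (j' \o (pS \o q)))%VF.
split; try by apply: memvD; repeat apply: hom_comp => //.
apply/lfunP=> x; rewrite !(comp_lfunE, add_lfunE, id_lfunE) !linearD /=.
rewrite (bi_piE b) (bi_pj b) (bi_qi b) (bi_qjE b) !linear0 addr0 add0r.
by rewrite (compE pSE) id_lfunE (bi_sumE b').
Qed.

Lemma indep_merge s1 s2 : indep s1 -> indep s2 -> exists s,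
  [/\ indep s, forall Y, List.In Y s -> List.In Y s1 \/ List.In Y s2
    & forall Y, List.In Y s1 \/ List.In Y s2 -> exists2 Z, List.In Z s & iso Y Z].
Proof.
move=> i1 i2; elim: s1 i1 => [_|X s1 IH [Xi _ /IH[s [si sin sout]]]].
  by exists s2; split=> // [Y|Y []//]; [right|move=> Ys; exists Y => //; apply: iso_refl].
case: (classic (exists2 Z, List.In Z s & iso X Z)) => [XZ|nX].
  exists s; split=> // [Y /sin[]|Y [[<-//|Ys1]|Ys2]]; first by left; right.
  - by right.
  - by apply: sout; left.
  - by apply: sout; right.
exists (X :: s); split=> /= [|Y [->|/sin[]]|Y [[<-|Ys1]|Ys2]].
- by split=> // Y Ys iXY; apply: nX; exists Y.
- by left; left.
- by left; right.
- by right.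
- by exists X; [left|apply: iso_refl].
- by have [|Z] := sout Y; [left|exists Z => //; right].
- by have [|Z] := sout Y; [right|exists Z => //; right].
Qed.

(** Multiplicities are discarded, so [M] is recovered from the list only in the sense of
    [in_add]. *)
Lemma indep_decomp M : exists s,
  [/\ indep s, forall Y, List.In Y s -> retract Y M & in_add (fun Y => List.In Y s) M].
Proof.
have [n] := ubnP (\dim {:M}); elim: n M => // n IH M /ltnSE leMn.
case: (classic (zero_module M)) => [M0|M0].
  by exists [::]; split=> //; rewrite /in_add (proj1 (zero_idP M) M0); apply: Factsum0.
case: (classic (indecomposable M)) => [Mi|nMi].
  exists [:: M]; split=> //= [Y [<-//|//]|]; first exact: retract_refl.
  by apply: retract_in_add (retract_refl M); left.
have [N [Q [i [j [p [q [b ltN ltQ]]]]]]] := decomposable M0 nMi.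
have [rN rQ] := biprod_retract b.
have [s1 [i1 r1 a1]] := IH N (leq_trans ltN leMn).
have [s2 [i2 r2 a2]] := IH Q (leq_trans ltQ leMn).
have [s [si sin sout]] := indep_merge i1 i2.
exists s; split=> // [Y /sin[/r1|/r2] r|].
- exact: retract_trans r rN.
- exact: retract_trans r rQ.
have tr s' : (forall Y, List.In Y s' -> List.In Y s1 \/ List.In Y s2) ->
    forall Y, List.In Y s' -> in_add (fun Y => List.In Y s) Y.
  move=> ss Y /ss/sout[Z Zs /iso_retract]; exact: retract_in_add.
apply: in_add_biprod b _ _.
  by apply: factsum_trans a1; apply: tr => Y; left.
by apply: factsum_trans a2; apply: tr => Y; right.
Qed.

End KrullSchmidt.

(** * The minimal faithful tilting module *)

Section MinimalTilting.
Variables (K : fieldType) (A : falgType K) (tl : amod A -> Prop).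
Implicit Types M N Q X Y Z T : amod A.
Hypothesis tl_retract : forall N M, retract N M -> tl M -> tl N.
(** For tilting modules this comes from a duality that fixes each of them up to isomorphism. *)
Hypothesis tl_gencog : forall X T, tl X -> tl T -> gen X T <-> cog X T.

(* For an embedding of A in a tilting module, with cokernel in F(Delta), sending 1 to t. *)
Record tilting_generator T (t : T) : Prop := TiltingGenerator {
  tg_tl : tl T;
  tg_univ : forall X (x : X), tl X -> exists2 phi, phi \in homA T X & phi t = x;
  tg_sep : exists T1 (q : 'Hom(T, T1)), [/\ tl T1, q \in homA T T1, q t = 0 &
    forall z, q z = 0 -> exists a, z = act T a t];
  tg_free : forall a, act T a t = 0 -> a = 0 }.

(** The Fitting image of a noninjective endomorphism fixing [t] is a proper summand of [T] that
    contains [t] and inherits all four properties. *)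
Lemma minimal_generator T (t : T) : tilting_generator t -> exists T0 (t0 : T0),
  tilting_generator t0 /\
  forall phi, phi \in homA T0 T0 -> phi t0 = t0 -> forall x, phi x = 0 -> x = 0.
Proof.
have [n] := ubnP (\dim {:T}); elim: n T t => // n IH T t /ltnSE leTn tg.
have [tT tu [T1 [q [tT1 hq qt sep]]] tf] := tg.
case: (classic (exists phi, [/\ phi \in homA T T, phi t = t & exists2 x, phi x = 0 & x <> 0])).
  move=> [phi [hphi phit [x phix x0]]].
  have [N [i [p [m [hi hp pi kp ip]]]]] := fitting hphi.
  have piE z : p (i z) = z by rewrite (compE pi) id_lfunE.
  have [y yE] := ip t.
  have {}yE : t = i y by rewrite -yE; elim: m.+1 => //= k <-.
  have rN : retract N T by exists i, p.
  apply: (IH N y).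
    apply: leq_trans leTn; rewrite ltnNge; apply/negP=> le.
    have ii z : i z = 0 -> z = 0 by move=> iz; rewrite -(piE z) iz linear0.
    have [z zE] := inj_dim_surj ii le x; apply: x0.
    have /kp := iter_fix0 m phix; rewrite -zE piE => ->; exact: linear0.
  split; first exact: tl_retract rN tT.
  - move=> X z tX; have [psi hpsi psiE] := tu X z tX.
    by exists (psi \o i)%VF; [apply: hom_comp|rewrite comp_lfunE -yE].
  - exists T1, (q \o i)%VF; split=> //; first exact: hom_comp.
      by rewrite comp_lfunE -yE.
    move=> z; rewrite comp_lfunE => /sep[a aE]; exists a.
    by rewrite -(piE z) aE yE -(homAE _ _ hi) piE.
  - by move=> a ay; apply: tf; rewrite yE -(homAE _ _ hi) ay linear0.
move=> nphi; exists T, t; split=> // phi hphi phit x phix; apply: NNPP => x0.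
by apply: nphi; exists phi; split=> //; exists x.
Qed.

Section Generator.
Variables (T0 : amod A) (t0 : T0).
Hypothesis tg : tilting_generator t0.
Hypothesis tmin : forall phi, phi \in homA T0 T0 -> phi t0 = t0 ->
  forall x, phi x = 0 -> x = 0.

(** Every element of [X] is an image of [t0], so [T0] generates [X], and [tl_gencog] applies. *)
Lemma generator_cog X : tl X -> cog X T0.
Proof.
move=> tX; apply/(tl_gencog tX (tg_tl tg)) => Z f hf f0; apply/lfunP=> x.
have [phi hphi <-] := tg_univ tg x tX.
by rewrite (compE (f0 _ hphi)) !zero_lfunE.
Qed.

(** The dimension of this End(T0)-submodule is the induction measure of [ann_vector]. *)
Lemma end_orbit (z : T0) : exists V : {vspace T0},
  forall v, v \in V <-> exists2 e, e \in homA T0 T0 & v = e z.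
Proof.
have [|ev evE] := @ex_lfun K 'End(T0) T0 (fun e => e z).
  by move=> k f g; rewrite add_lfunE scale_lfunE.
exists (ev @: homA T0 T0)%VS => v; split=> [/memv_imgP[e he ->]|[e he ->]].
  by exists e.
by rewrite -evE memv_img.
Qed.

(* Minimality of t0 puts {h | h t0 = 0} in the radical of End(T0), so it annihilates some
   nonzero vector of every nonzero End(T0)-submodule of T0. *)
Lemma ann_vector T' (z : T0) :
  z <> 0 -> (forall phi, phi \in homA T0 T' -> phi z = 0) -> exists z' : T0,
  [/\ z' <> 0, forall phi, phi \in homA T0 T' -> phi z' = 0 &
      forall h, h \in homA T0 T0 -> h t0 = 0 -> h z' = 0].
Proof.
have [V VP] := end_orbit z.
have [n] := ubnP (\dim V); elim: n V z VP => // n IH V z VP /ltnSE leVn z0 kz.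
case: (classic (exists h, [/\ h \in homA T0 T0, h t0 = 0 & h z <> 0])); last first.
  move=> nh; exists z; split=> // h hh ht; apply: NNPP => hz; apply: nh.
  by exists h.
move=> [h [hh ht hz]]; have [V' VP'] := end_orbit (h z).
have sV : (V' <= V)%VS.
  apply/subvP=> v /VP'[e he ->]; apply/VP; exists (e \o h)%VF; first exact: hom_comp.
  by rewrite comp_lfunE.
apply: (IH V' (h z) VP' _ hz) => [|phi hphi]; last first.
  by rewrite -comp_lfunE; apply: kz; apply: hom_comp.
(* If the orbit did not shrink, then [z = g (h z)] for some [g], and [\1 - g \o h] would fix [t0]
   and kill [z], against minimality. *)
apply: leq_trans leVn; rewrite ltnNge; apply/negP=> le.
have : z \in V'.
  rewrite (eqP (_ : V' == V)) ?eqEdim ?sV //; apply/VP.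
  by exists \1%VF; rewrite ?hom_id ?id_lfunE.
case/VP'=> g hg zE; apply: z0; apply: (tmin (phi := (\1 - (g \o h))%VF)).
- by apply: memvB; [apply: hom_id|apply: hom_comp].
- by rewrite !(add_lfunE, opp_lfunE, comp_lfunE, id_lfunE) ht linear0 subr0.
- by rewrite !(add_lfunE, opp_lfunE, comp_lfunE, id_lfunE) -zE subrr.
Qed.

Lemma faithful_cog T' : tl T' -> faithful T' -> cog T0 T'.
Proof.
move=> tT' fT' Z f hf f0; apply: NNPP => /nz_lfun[w fw].
have [|z [z0 kz hz]] := ann_vector fw (T' := T').
  by move=> phi hphi; rewrite (compE (f0 _ hphi)) zero_lfunE.
have [T1 [q [tT1 hq qt sep]]] := tg_sep tg.
(* For every [psi : T1 -> T0] the map [psi \o q] kills [t0] and hence [z]; as [T0] cogenerates [T1],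
   this gives [q z = 0]. *)
have [a aE] : exists a, z = act T0 a t0.
  apply: sep; apply: cog_elt (generator_cog tT1) _ => psi hpsi.
  by rewrite -comp_lfunE; apply: hz; [apply: hom_comp|rewrite comp_lfunE qt linear0].
(* An element of [T'] is some [phi t0], and [a] sends it to [phi z = 0]. *)
apply: z0; rewrite aE (fT' a) ?linear0 ?zero_lfunE //.
apply/lfunP=> x; have [phi hphi <-] := tg_univ tg x tT'.
by rewrite zero_lfunE -(homAE _ _ hphi) -aE kz.
Qed.

Lemma faithful_in_add T' : tl T' -> faithful T' -> in_add (eq T') T0.
Proof.
move=> tT' fT'.
have g : gen T0 T' by apply/(tl_gencog (tg_tl tg) tT')/faithful_cog.
have s := ses_sub (trace T' T0); set c := quot_hom _ in s.
have c0 : c = 0.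
  apply: g (ses_q s) _ => phi hphi; apply/lfunP=> x; rewrite comp_lfunE zero_lfunE.
  have [|y ->] := @sub_incl_mem _ _ _ (trace T' T0) (phi x); last exact: ses_comp s _.
  by apply: (subvP (trace_sup hphi)); rewrite memv_img ?memvf.
have : t0 \in trace_space T' T0.
  have [|y ->] := ses_ker s (y := t0); first by rewrite c0 zero_lfunE.
  by rewrite sub_inclE; apply: subvsP.
case/memv_sumP=> v vi vE.
(* Each [v i] is the image of an element of [T'], itself an image of [t0]; so [v i] is the value at
   [t0] of an endomorphism factoring through [T']. *)
have [r fr rE] : exists2 r, factsum (eq T') r & r t0 = \sum_(i < \dim (homA T' T0)) v i.
  elim/big_ind: _ => [|x y [r fr <-] [r' fr' <-]|i _].
  - by exists 0; [apply: Factsum0|rewrite zero_lfunE].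
  - by exists (r + r'); [apply: factsum_add|rewrite add_lfunE].
  have /memv_imgP[x _ ->] := vi i isT; have [phi hphi <-] := tg_univ tg x tT'.
  exists (((vbasis (homA T' T0))`_i \o phi) + 0)%VF.
    apply: FactsumD (Factsum0 _ _) => //; apply: vbasis_mem.
    by rewrite mem_nth // size_tuple.
  by rewrite addr0 comp_lfunE.
(* [r] fixes [t0], so it is bijective by minimality, and [u \o r] writes the identity as a sum of
   maps through [T']. *)
have hr := factsum_hom fr; rewrite -vE in rE; have ri := tmin hr rE.
have [u [hu ur _]] := bij_hom hr ri (inj_dim_surj ri (leqnn _)).
rewrite /in_add -ur -[r]comp_lfun1r; exact: factsum_comp (hom_id _) hu fr.
Qed.

Lemma in_add_faithful T : in_add (eq T) T0 -> faithful T.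
Proof.
rewrite /in_add => aT a aT0; apply: (tg_free tg).
rewrite -[X in act _ _ X]id_lfunE; elim: aT => [|Y f g r E hf hg _ IH]; last subst Y.
  by rewrite zero_lfunE linear0.
by rewrite add_lfunE linearD /= IH addr0 comp_lfunE -(homAE _ _ hg) aT0 zero_lfunE linear0.
Qed.

Lemma in_add_double_centralizer T : tl T -> in_add (eq T) T0 -> double_centralizer T.
Proof.
move=> tT aT; have fT := in_add_faithful aT.
have inj a b : canonical_map T a = canonical_map T b -> a = b.
  move/(congr1 vsval) => /= E; apply/eqP; rewrite -subr_eq0; apply/eqP/fT.
  by rewrite linearB /= E subrr.
(* The boolean equality lets [xchoose] pick preimages. *)
suff surj y : exists a, canonical_map T a == y.
  pose h y := xchoose (surj y); have hP y : canonical_map T (h y) = y.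
    exact/eqP/(xchooseP (surj y)).
  by exists h => // a; apply: inj.
have [f hf] : exists2 f : 'End(T), f \in end_endA T & f = vsval y.
  by exists (vsval y) => //; apply: subvsP.
suff fE : exists a, f = act T a.
  by move=> yE; have [a aE] := fE; exists a; apply/eqP/val_inj; rewrite /= -yE aE.
have fC g : g \in homA T T -> forall x, f (g x) = g (f x).
  move=> hg x; move/intwP/(_ (Subvs hg))/lfunP/(_ x): hf.
  by rewrite !comp_lfunE.
(* [f0] is the sum of the [g' \o (f \o f')] over a decomposition of the identity of [T0] through
   [T]. The identity stays visible so that the induction on [aT] replaces it by partial sums. *)
have [f0 f0E] : exists f0 : 'End(T0), forall h, h \in homA T0 T ->
    forall x, h (f0 x) = f (h ((\1%VF : 'End(T0)) x)).
  elim: aT => [|Y f' g' r E hf' hg' _ [f0 f0E]]; last subst Y.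
    by exists 0 => h hh x; rewrite !zero_lfunE !linear0.
  exists ((g' \o (f \o f')) + f0)%VF => h hh x.
  rewrite !(add_lfunE, comp_lfunE) !linearD /= f0E //; congr (_ + _).
  by rewrite -!(comp_lfunE h g') fC ?comp_lfunE //; apply: hom_comp.
have cogT x : (forall phi, phi \in homA T0 T -> phi x = 0) -> x = 0.
  move=> kx; rewrite -(id_lfunE x); elim: aT => [|Y f' g' r E hf' hg' _ IH]; last subst Y.
    by rewrite zero_lfunE.
  by rewrite add_lfunE comp_lfunE kx // linear0 IH addr0.
have [T1 [q [tT1 hq qt sep]]] := tg_sep tg.
(* The composite of [q], [psi] and [phi] kills [t0], so by [f0E] it kills [f0 t0]. As [T]
   cogenerates [T0] and [T0] cogenerates [T1], it follows that [q] kills [f0 t0]. *)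
have [a aE] : exists a, f0 t0 = act T0 a t0.
  apply: sep; apply: cog_elt (generator_cog tT1) _ => psi hpsi.
  apply: cogT => phi hphi; have h := hom_comp hq (hom_comp hpsi hphi).
  have := f0E _ h t0; rewrite id_lfunE !comp_lfunE qt !linear0 //.
exists a; apply/lfunP=> x; have [phi hphi <-] := tg_univ tg x tT.
by have := f0E _ hphi t0; rewrite id_lfunE aE => <-; rewrite (homAE _ _ hphi).
Qed.

(** The list consists of the indecomposable summands of [T0], one from each isomorphism class. For a
    faithful [T'] in [tl], [T0] is in add [T'], so each of them is a summand of [T'], and
    [indep_retract] splits them off together. *)
Lemma minimal_tilting : exists s,
  [/\ indep s, forall Y, List.In Y s -> tl Y,
      [/\ tl (dsums s), faithful (dsums s) & double_centralizer (dsums s)]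
    & forall T', tl T' -> faithful T' -> retract (dsums s) T'].
Proof.
have [s [si rs aT0]] := indep_decomp T0; exists s.
have tT := tl_retract (indep_retract si rs) (tg_tl tg).
have aT : in_add (eq (dsums s)) T0.
  by apply: factsum_trans aT0 => Y /retract_dsums; apply: retract_in_add.
split=> // [Y /rs r||T' tT' fT']; first exact: tl_retract r (tg_tl tg).
  split=> //; first exact: in_add_faithful.
  exact: in_add_double_centralizer.
apply: indep_retract => // Y Ys.
have Yi : indecomposable Y.
  by elim: (s) si Ys => //= Z t IH [h1 _ h3] [<-|]; [|apply: IH].
by have [Z <-] := indec_in_add Yi (in_add_retract (rs Y Ys) (faithful_in_add tT' fT')).
Qed.

End Generator.
End MinimalTilting.

(** * Existence and uniqueness *)

Lemma indep_family (K : fieldType) (A : falgType K) (s : seq (amod A)) : indep s ->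
  [/\ forall i, i < size s -> indecomposable (nth (mod0 A) s i) /\ List.In (nth (mod0 A) s i) s
    & forall i j, i < size s -> j < size s ->
        iso (nth (mod0 A) s i) (nth (mod0 A) s j) -> i = j]%N.
Proof.
elim: s => //= X s IH [Xi Xs /IH[h1 h2]]; split=> [[|i] /= lti|[|i] [|j] //= lti ltj].
- by split=> //; left.
- by have [] := h1 i lti; split=> //; right.
- by have [_ /Xs] := h1 j ltj.
- by have [_ /Xs h /iso_sym] := h1 i lti.
- by move/(h2 i j lti ltj) => ->.
Qed.

Theorem theorem1p11 (K : fieldType) (A : falgType K)
    (d : Order.disp_t) (Lam : finPOrderType d) (L P I : Lam -> amod A)
    (nabla : forall lam, submod (I lam)) :
  complete_simples L -> split_simples L ->
  (forall lam, projective_cover (P lam) (L lam)) ->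
  (forall lam, injective_hull (I lam) (L lam)) ->
  quasi_hereditary L P ->
  (forall lam, costandard_sub L (nabla lam)) ->
  (exists D : cofunctor A, simple_preserving_duality D) ->
  let good (T : amod A) :=
    [/\ faithful T, basic_tilting P nabla T, double_centralizer T
      & forall T' : amod A, faithful T' -> tilting P nabla T' ->
          double_centralizer T' -> direct_summand T T'] in
  exists T : amod A, good T /\ forall T2 : amod A, good T2 -> iso T T2.
Proof.
move=> Lsimple _ Pcover Ihull qh nablaP [D [Dex [eta [eta_iso eta_nat]] _ Dsimple]] good.
have nablaD := nabla_iso Lsimple Pcover qh Dex eta_iso eta_nat Dsimple Ihull nablaP.
(* By [nablaD], filtrations by costandard modules and by the modules [D (Delta lam)] are the
   same. *)
have tiltP T : tilting P nabla T <-> tilt P D T.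
  split=> [] [fD [s fN]]; split=> //; exists s; apply: filt_fam fN => lam //.
  exact: iso_sym.
have tr N M : retract N M -> tilting P nabla M -> tilting P nabla N.
  move=> rNM /tiltP tM; apply/tiltP.
  exact: (tilt_retract Lsimple Pcover qh Dex eta_iso eta_nat Dsimple rNM tM).
have sd X : tilting P nabla X -> iso (D X) X.
  by move/tiltP; apply: (tilt_selfdual Lsimple Pcover qh Dex eta_iso eta_nat Dsimple).
have gc X T : tilting P nabla X -> tilting P nabla T -> gen X T <-> cog X T.
  move=> /sd sX /sd sT; split=> h.
    exact: cog_iso sX sT (gen_D Dex eta_iso eta_nat h).
  exact: gen_iso sX sT (cog_D Dex eta_iso eta_nat h).
have hull M : FDelta P M -> exists (T C : amod A) (a : 'Hom(M, T)) (b : 'Hom(T, C)),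
    [/\ ses a b, FDelta P C & tilt P D T].
  exact: (tilting_hull Lsimple Pcover qh Dex eta_iso eta_nat Dsimple).
(* Ext^1 vanishes on the projective regular module, so [extp_FDelta] applies. *)
have fA : FDelta P (regular A).
  apply: (extp_FDelta Lsimple Pcover qh Dex eta_iso eta_nat Dsimple) => mu.
  apply: (liftp_extp Dex eta_iso eta_nat).
  exact/projective_liftp/regular_projective.
have [T0 [C [a [b [sab fC tT0]]]]] := hull _ fA.
have [T1 [C' [a' [b' [sab' _ tT1]]]]] := hull _ fC.
have aE r : a r = act T0 r (a (1 : A)).
  by rewrite -(homAE _ _ (ses_i sab)) regularE mulr1.
have tg : tilting_generator (tilting P nabla) (a (1 : A)).
  split.
  - exact/tiltP.
  - move=> X x /tiltP[_ nX]; have [f hf fE] := regular_map x.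
    (* The map sending 1 to [x] extends along [a] because Ext^1(C, X) = 0. *)
    have e := FDelta_FNabla Lsimple Pcover qh Dex eta_iso eta_nat Dsimple fC nX.
    have [h hh hE] := e _ _ _ _ _ sab hf; exists h => //.
    by rewrite (compE hE) fE act1 id_lfunE.
  - exists T1, (a' \o b)%VF; split.
    + exact/tiltP.
    + exact: hom_comp (ses_q sab) (ses_i sab').
    + by rewrite comp_lfunE (ses_comp sab) linear0.
    + move=> z; rewrite comp_lfunE => /(ses_inj sab')/(ses_ker sab)[r ->].
      by exists r; apply: aE.
  - by move=> r; rewrite -aE => /(ses_inj sab).
have [T' [t' [tg' tmin]]] := minimal_generator tr tg.
have [s [si sl [tS fS dS] Smin]] := minimal_tilting tr gc tg' tmin.
have goodS : good (dsums s).
  have [sN sI] := indep_family si.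
  split=> // [|X fX tX _]; last by apply/direct_summandP; apply: Smin.
  split=> //; exists (size s), (fun i => nth (mod0 A) s i); split.
  - move=> i; have [h1 h2] := sN i (ltn_ord i); split=> //; exact: sl.
  - by move=> i j /sI e; apply/val_inj/e.
  - rewrite /dsums foldrE (big_nth (mod0 A)) big_mkord; exact: iso_refl.
exists (dsums s); split=> // T2 [fT2 [tT2 _] dT2 minT2].
have [_ _ _ minS] := goodS.
(* Each of the two modules is a summand of the other, so their dimensions agree. *)
apply: retract_iso; first exact/direct_summandP/minS.
exact/retract_dim/direct_summandP/minT2.
Qed.
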